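(* Let $n\ge 1$ and let $\chi\in\mathcal W^+_p$ for some $p\ge1$. Suppose $[0,1]\ni t\mapsto h_t\in\mathcal P_n$ is a smooth curve with $h_0\ne h_1$, and let $[0,1]\ni t\mapsto g_t\in\mathcal P_n$ be the candidate geodesic joining $h_0$ and $h_1$, i.e. the unique solution of $\frac{d}{dt}\big(g_t^{-1}\dot g_t\big)=0$ with $g_0=h_0$, $g_1=h_1$. Then $$l_\chi(\{h_t\})\ge l_\chi(\{g_t\}).$$ In particular, $d_{\chi,\mathcal P_n}(h_0,h_1)=l_\chi(\{g_t\})>0$; hence $(\mathcal P_n,d_{\chi,\mathcal P_n})$ is a bona fide geodesic metric space, whose metric geodesics are governed by the equation $\frac{d}{dt}\big(g_t^{-1}\dot g_t\big)=0$.
   Context: $\mathcal W^+_p$ ($p\ge1$) is the set of functions $\chi:\mathbb R\to\mathbb R$ that are convex, even, lower semicontinuous, with $\chi(0)=0$, $1\in\partial\chi(1)$ ($\partial\chi(l)$ denotes the set of subgradients of $\chi$ at $l$), and $l\chi'(l)\le p\,\chi(l)$ for all $l>0$, where $\chi'(l)\in\partial\chi(l)$. $\mathcal P_n$ is the manifold of positive definite Hermitian $n\times n$ matrices, with $T_h\mathcal P_n=\mathrm{Herm}_n$, the Hermitian $n\times n$ matrices. For $h\in\mathcal P_n$, $\phi\in\mathrm{Herm}_n$ put $\phi^h:=h^{-1}\phi$, which is diagonalizable with real eigenvalues. For a matrix $A=U\,\mathrm{diag}(\mu_1,\dots,\mu_n)\,U^{-1}$ with real $\mu_j$ and $f:\mathbb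 R\to\mathbb R$, $f(A):=U\,\mathrm{diag}(f(\mu_1),\dots,f(\mu_n))\,U^{-1}$. The Orlicz–Finsler norm is $$\|\phi\|_{\chi,h}:=\inf\Big\{r>0:\ \frac1n\mathrm{tr}\Big[\chi\Big(\frac{\phi^h}{r}\Big)\Big]\le\chi(1)\Big\}.$$ The length of a smooth curve is $l_\chi(\{h_t\})=\int_0^1\|\dot h_t\|_{\chi,h_t}\,dt$, and $d_{\chi,\mathcal P_n}(v_0,v_1)$ is the infimum of $l_\chi(\{u_t\})$ over smooth curves $[0,1]\ni t\mapsto u_t\in\mathcal P_n$ with $u_0=v_0$, $u_1=v_1$. A metric geodesic of $(M,d)$ is a curve $[0,1]\ni t\mapsto g_t$ with $d(g_a,g_b)=|a-b|\,d(g_0,g_1)$ for all $a,b\in[0,1]$; a geodesic metric space is one in which any two points are joined by a metric geodesic. *)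

(* Defs.v *)
From HB Require Import structures.
From mathcomp Require Import all_boot all_order all_algebra.
From mathcomp Require Import all_classical all_reals all_analysis.
From mathcomp Require Import sesquilinear spectral complex.

Set Implicit Arguments.
Unset Strict Implicit.
Unset Printing Implicit Defensive.

Import Order.TTheory GRing.Theory Num.Theory.
Import numFieldNormedType.Exports.

Local Open Scope classical_set_scope.
Local Open Scope complex_scope.
Local Open Scope sesquilinear_scope.
Local Open Scope ring_scope.

Section Weights.
Variable R : realType.
Implicit Types (chi : R -> R) (l p v : R).

Definition subdifferential chi l : set R :=
  [set v | forall x, chi l + v * (x - l) <= chi x].

Definition Wplus p : set (R -> R) := [set chi |
  [/\ convex_function (setT : set R^o) chi,
      (forall l, chi (- l) = chi l),
      lower_semicontinuous (EFin \o chi)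
    & chi 0 = 0] /\
  subdifferential chi 1 1 /\
  (forall l v, 0 < l -> subdifferential chi l v -> l * v <= p * chi l)].

End Weights.

Section OrliczFinsler.
Variables (R : realType) (n : nat).
Local Notation M := 'M[R[i]]_n.
Implicit Types (A h phi v : M) (u g : R -> M) (chi f : R -> R).

Definition posdefmx : set M := [set h | h \is hermsymmx /\
  forall x : 'cV[R[i]]_n, x != 0 -> 0 < (x ^t* *m h *m x) 0 0].

(* f(A) for A diagonalizable with real eigenvalues, and 0 for any other A;
   f(A) does not depend on the diagonalization (U, mu) picked by xget *)
Definition mxfun f A : M :=
  xget 0 [set B | exists (U : M) (mu : 'rV[R]_n),
    [/\ U \in unitmx,
        A = U *m diag_mx (map_mx (real_complex R) mu) *m invmx U
      & B = U *m diag_mx (map_mx (fun x => (f x)%:C) mu) *m invmx U]].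

(* the inequality is between elements of R[i]; it says that the left-hand side
   is real and bounded by chi 1 *)
Definition orlicz_norm chi h phi : R :=
  inf [set r : R | 0 < r /\
    n%:R^-1 * \tr (mxfun chi ((r^-1)%:C *: (invmx h *m phi))) <= (chi 1)%:C].

(* time derivative, entry by entry, on real and imaginary parts *)
Definition mxdot (u : R -> M) : R -> M := fun t =>
  \matrix_(i, j) (derive1 (fun s => complex.Re (u s i j)) t +i*
                  derive1 (fun s => complex.Im (u s i j)) t).

Definition smooth (f : R -> R) := forall k t, derivable (derive1n k f) t 1.

(* A smooth curve on [0,1] is represented by a smooth extension to R (smoothness
   up to the end points); only the values on [0,1] are constrained to be positive
   definite, and only these values matter below. *)
Definition smooth_curve : set (R -> M) := [set u : R -> M |
  (forall i j, smooth (fun t => complex.Re (u t i j)) /\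
               smooth (fun t => complex.Im (u t i j))) /\
  (forall t, 0 <= t <= 1 -> posdefmx (u t))].

Definition geodesic_equation u :=
  forall t, 0 <= t <= 1 -> mxdot (fun s => invmx (u s) *m mxdot u s) t = 0.

Definition candidate_geodesic v0 v1 g :=
  [/\ smooth_curve g, geodesic_equation g, g 0 = v0 & g 1 = v1].

Definition curve_length chi u : \bar R :=
  \int[lebesgue_measure]_(t in `[0, 1]) (orlicz_norm chi (u t) (mxdot u t))%:E.

Definition orlicz_dist chi v0 v1 : \bar R :=
  ereal_inf [set curve_length chi u |
             u in [set u | [/\ smooth_curve u, u 0 = v0 & u 1 = v1]]].

End OrliczFinsler.

Section MetricSpaces.
Variables (R : realType) (T : Type).
Implicit Types (S : set T) (d : T -> T -> \bar R).
Local Open Scope ereal_scope.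

Definition is_metric_space S d :=
  [/\ forall x y, S x -> S y -> d x y \is a fin_num /\ 0 <= d x y,
      forall x y, S x -> S y -> (d x y = 0 <-> x = y),
      forall x y, S x -> S y -> d x y = d y x
    & forall x y z, S x -> S y -> S z -> d x z <= d x y + d y z].

Definition metric_geodesic S d (g : R -> T) :=
  (forall t, (0 <= t <= 1)%R -> S (g t)) /\
  forall a b, (0 <= a <= 1)%R -> (0 <= b <= 1)%R ->
    d (g a) (g b) = `|a - b|%:E * d (g 0%R) (g 1%R).

Definition is_geodesic_metric_space S d :=
  is_metric_space S d /\
  forall x y, S x -> S y ->
    exists g, [/\ metric_geodesic S d g, g 0%R = x & g 1%R = y].

End MetricSpaces.

(* Main.v *)
Require Import Defs.
From mathcomp Require Import all_boot all_order all_algebra.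
From mathcomp Require Import all_classical all_reals all_analysis.
From mathcomp Require Import measurable_realfun sesquilinear spectral complex.
From mathcomp Require Import ring lra.

(* The eigenvalues of log(x^-1 y) define log_dist x y, the length of the candidate
   geodesic from x to y, and the point is that t |-> log_dist x (h t) grows at
   most at the speed of the curve h. To bound log_dist x y in terms of
   log_dist x z for z near y, take the diagonal of log z in a basis which is
   orthonormal for x and orthogonal for y: by Schur's theorem the symmetric gauge
   of this diagonal is at most log_dist x z, and by the second-order bound
   |ln m - ln l - (m - l) / l| <= (m - l)^2 / c^2 integrated against the spectral
   measures of z it differs from the logarithms of the eigenvalues of x^-1 y by
   the diagonal of z - y in a y-orthonormal basis, up to O(|z - y|^2). By Schur
   again that diagonal has gauge at most ||z - y||_y. Neither differentiability of
   eigenvalues nor of the matrix logarithm is needed. Integrating gives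
   log_dist x (h 1) - log_dist x (h 0) <= l(h), which for x = h 0 is the
   minimality of geodesics, and applied to a geodesic h gives the triangle
   inequality for log_dist. *)

Import Order.TTheory GRing.Theory Num.Theory.
Import numFieldNormedType.Exports.

Local Open Scope ring_scope.

Set Implicit Arguments.
Unset Strict Implicit.
Unset Printing Implicit Defensive.

(** * The gauge of a weight *)

(** The weight [chi] may have corners, so neither the norm nor the length has a first variation to
    compute. Increments with an explicit quadratic error take its place, and they can be summed
    because the error constant is uniform on [0,1]: compactness bounds the derivatives of the
    entries and keeps [h t] away from the singular matrices. The main convexity input is that doubly
    substochastic matrices do not increase the gauge, which is Jensen's inequality together with
    [chi 0 = 0]; deficient sums must be allowed, because a change of base point gives weights whose
    row and column sums are only bounded. The choice of basis carries the argument: being orthogonal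
    for [y], it becomes [y]-orthonormal when its vectors are rescaled, and this rescaling is exactly
    the factor [1 / l] in the derivative of [ln]. That is how the norm at the moving point [y]
    enters a distance computed at the fixed point [x]. *)

Section Weight.
Variables (R : realType) (p : R) (chi : R -> R).
Hypothesis hchi : Wplus p chi.

Lemma Wplus0 : chi 0 = 0. Proof. by case: hchi => -[]. Qed.

Lemma WplusN x : chi (- x) = chi x. Proof. by case: hchi => -[]. Qed.

Lemma Wplus_subgradient x : chi 1 + (x - 1) <= chi x.
Proof. by case: hchi => _ [/(_ x)]; rewrite mul1r. Qed.

Lemma Wplus_convex (t x y : R) : 0 <= t <= 1 ->
  chi (t * x + (1 - t) * y) <= t * chi x + (1 - t) * chi y.
Proof.
move=> t01; case: hchi => -[cvx _ _ _] _.
have t01' : Itv.spec (@Itv.num_sem R) (Itv.Real `[0%Z, 1%Z]) t.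
  by rewrite /= /Itv.num_sem /= num_real/= in_itv.
have := cvx (Itv.mk t01') x y; rewrite !inE => /(_ I I).
by rewrite /conv/= /GRing.scale/=.
Qed.

Lemma Wplus_ge0 x : 0 <= chi x.
Proof.
(* The midpoint of [x] and [- x] is 0, where [chi] vanishes. *)
have := @Wplus_convex 2^-1 x (- x).
rewrite (_ : 2^-1 * x + (1 - 2^-1) * - x = 0); last by field.
rewrite WplusN Wplus0 -mulrDl => H.
have : 0 <= (2^-1 + (1 - 2^-1)) * chi x by apply: H; lra.
by rewrite addrC subrK mul1r.
Qed.

Lemma Wplus_scale (t x : R) : 0 <= t <= 1 -> chi (t * x) <= t * chi x.
Proof. by move=> /(@Wplus_convex t x 0); rewrite Wplus0 !mulr0 !addr0. Qed.

Lemma Wplus_mono (x y : R) : `|x| <= `|y| -> chi x <= chi y.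
Proof.
have even_abs z : chi z = chi `|z| by case: (ger0P z); rewrite ?WplusN.
rewrite (even_abs x) (even_abs y) => xy.
have [y0|y0] := eqVneq y 0.
  by move: xy; rewrite y0 normr0 normr_le0 => /eqP ->; rewrite normr0.
have y1 : 0 < `|y| by rewrite normr_gt0.
have t01 : 0 <= `|x| / `|y| <= 1.
  by rewrite divr_ge0//= ler_pdivrMr ?mul1r.
have := Wplus_scale `|y| t01; rewrite divfK ?lt0r_neq0// => /le_trans; apply.
by rewrite ler_piMl ?Wplus_ge0//; case/andP: t01.
Qed.

(** The weights may sum to less than 1: the missing mass sits at 0, where [chi] vanishes. *)
Lemma Wplus_jensen (I : Type) (r : seq I) (P x : I -> R) :
  (forall i, 0 <= P i) -> \sum_(i <- r) P i <= 1 ->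
  chi (\sum_(i <- r) P i * x i) <= \sum_(i <- r) P i * chi (x i).
Proof.
move=> P0.
(* Splitting off one point leaves total mass [s - P a], so the induction runs over the homogeneous
   form with an arbitrary mass [s]. For [s = 0] the left-hand side is 0. *)
suff H (s : R) : 0 <= s -> \sum_(i <- r) P i <= s ->
    s * chi (s^-1 * \sum_(i <- r) P i * x i) <= \sum_(i <- r) P i * chi (x i).
  by move=> /(H _ ler01); rewrite mul1r invr1 mul1r.
elim: r s => [|a r IH] s s0; first by rewrite !big_nil mulr0 Wplus0 mulr0.
have S0 : 0 <= \sum_(j <- r) P j by apply: sumr_ge0.
rewrite !big_cons => Ps; have [s00|sn0] := eqVneq s 0.
  by rewrite s00 mul0r addr_ge0 ?mulr_ge0 ?Wplus_ge0// sumr_ge0// => i _;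
    rewrite mulr_ge0 ?Wplus_ge0.
have s1 : 0 < s by rewrite lt_def sn0.
have tP : 0 <= P a / s <= 1.
  by rewrite divr_ge0//= ler_pdivrMr ?mul1r//; lra.
(* Here [P a] exhausts the mass: the other weights vanish, and the convex splitting used below would
   divide by 0. *)
have [sPa|sPa] := eqVneq (s - P a) 0.
  have r0 : \sum_(j <- r) P j = 0 by lra.
  have Pas : P a = s by lra.
  have -> : \sum_(j <- r) P j * x j = 0.
    have := IH 0 (lexx _); move: r0; elim: r {IH S0 Ps} => [|b r IHr].
      by rewrite !big_nil.
    rewrite !big_cons => r0 _.
    have S0 : 0 <= \sum_(j <- r) P j by apply: sumr_ge0.
    have Pb := P0 b.
    have -> : P b = 0 by lra.
    rewrite mul0r add0r; apply: IHr; first by lra.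
    by rewrite mul0r => _; apply: sumr_ge0 => i _; rewrite mulr_ge0 ?Wplus_ge0.
  rewrite addr0 Pas mulKf// lerDl.
  by apply: sumr_ge0 => i _; rewrite mulr_ge0 ?Wplus_ge0.
have := Wplus_convex (x a) ((s - P a)^-1 * \sum_(j <- r) P j * x j) tP.
rewrite -(ler_pM2l s1) => H.
have -> : s^-1 * (P a * x a + \sum_(j <- r) P j * x j) = P a / s * x a +
    (1 - P a / s) * ((s - P a)^-1 * \sum_(j <- r) P j * x j).
  by field; rewrite sn0 sPa.
apply: (le_trans H); rewrite mulrDr !mulrA mulrBr mulr1 mulrCA divff// mulr1.
by have -> : s * P a / s = P a by [field]; rewrite lerD2l; apply: IH; lra.
Qed.

End Weight.

(** * The Luxemburg norm on real vectors *)

Section Gauge.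
Variables (R : realType) (n : nat) (chi : R -> R).
Implicit Types (mu nu : 'rV[R]_n) (r : R).

Definition gauge_set mu : set R :=
  [set r | 0 < r /\ \sum_i chi (r^-1 * mu 0 i) <= n%:R * chi 1].

Definition gauge mu : R := inf (gauge_set mu).

Lemma gauge_ge0 mu : 0 <= gauge mu.
Proof.
rewrite /gauge; have [->|S0] := eqVneq (gauge_set mu) set0; first by rewrite inf0.
apply: lb_le_inf; first exact/set0P.
by move=> r [/ltW].
Qed.

Lemma gauge_le mu r : gauge_set mu r -> gauge mu <= r.
Proof. by move=> mur; apply: ge_inf => //; exists 0 => s [/ltW]. Qed.

Variable p : R.
Hypothesis hchi : Wplus p chi.

Lemma gauge_setP mu r : 0 < r -> (forall i, `|mu 0 i| <= r) -> gauge_set mu r.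
Proof.
move=> r0 mur; split=> //; rewrite mulr_natl -[X in _ *+ X]card_ord -sumr_const.
apply: ler_sum => i _; apply: (Wplus_mono hchi).
by rewrite normrM normfV (gtr0_norm r0) normr1 mulrC ler_pdivrMr ?mul1r.
Qed.

Lemma gauge_set_up mu r s : gauge_set mu r -> r <= s -> gauge_set mu s.
Proof.
move=> [r0 mur] rs; have s0 := lt_le_trans r0 rs; split => //.
apply: le_trans mur; apply: ler_sum => i _; apply: (Wplus_mono hchi).
rewrite !normrM ler_wpM2r// !normfV !gtr0_norm// lef_pV2 ?posrE//.
Qed.

(** The set is upward closed, so it contains everything above its infimum. Estimates are made at
    [gauge mu + e] and [e] is then sent to 0, so attainment of the infimum never comes up. *)
Lemma gauge_lt mu r : gauge mu < r -> gauge_set mu r.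
Proof.
move=> mur; have : has_inf (gauge_set mu).
  split; last by exists 0 => s [/ltW].
  exists (1 + \sum_i `|mu 0 i|); apply: gauge_setP.
    by rewrite ltr_wpDr// sumr_ge0.
  move=> i; rewrite (bigD1 i)//= addrCA lerDl addr_ge0// sumr_ge0//.
move=> /(@inf_adherent _ _ (r - gauge mu)); rewrite subr_gt0 => /(_ mur).
move=> [s mus]; rewrite addrC subrK => /ltW sr.
exact: gauge_set_up mus sr.
Qed.

Lemma gauge_le_sup mu r : 0 <= r -> (forall i, `|mu 0 i| <= r) -> gauge mu <= r.
Proof.
move=> r0 mur; apply/ler_addgt0Pr => e e0; apply/gauge_le/gauge_setP.
  by rewrite ltr_wpDl.
by move=> i; apply: (le_trans (mur i)); rewrite lerDl ltW.
Qed.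

(** By the subgradient at 1, [chi x >= chi 1 + (x - 1)]. One term of the sum is at most the whole,
    so for [r] above the gauge, [|mu_i| / r <= (n - 1) * chi 1 + 1 <= n], since [chi 1 <= 1]. This
    makes the gauge definite. *)
Lemma gauge_ge_coord mu i : `|mu 0 i| <= n%:R * gauge mu.
Proof.
have n0 : (0 : R) < n%:R by rewrite ltr0n; case: n mu i => [|//] mu [].
rewrite mulrC -ler_pdivrMr//.
apply/ler_addgt0Pr => e e0.
have /gauge_lt[r0] : gauge mu < gauge mu + e by rewrite ltrDl.
set r := gauge mu + e in r0 *.
rewrite (bigD1 i)//= => H.
have abs_sub : chi 1 + (r^-1 * `|mu 0 i| - 1) <= chi (r^-1 * mu 0 i).
  apply: le_trans (Wplus_subgradient hchi _) _; apply: (Wplus_mono hchi).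
  by rewrite !normrM normr_id.
have S0 : 0 <= \sum_(j < n | j != i) chi (r^-1 * mu 0 j).
  by apply: sumr_ge0 => j _; exact: (Wplus_ge0 hchi).
have c1 : chi 1 <= 1.
  by have := Wplus_subgradient hchi 0; rewrite (Wplus0 hchi); lra.
have n1 : 1 <= n%:R :> R by rewrite ler1n -(ltr0n R).
have key : r^-1 * `|mu 0 i| <= n%:R.
  have : (n%:R - 1) * chi 1 <= (n%:R - 1) * 1 by rewrite ler_wpM2l// subr_ge0.
  by rewrite mulrBl; lra.
by rewrite ler_pdivrMr// -ler_pdivrMl.
Qed.

Lemma gauge_eq0 mu : gauge mu = 0 -> mu = 0.
Proof.
move=> mu0; apply/rowP => i; apply/eqP; rewrite mxE -normr_le0.
by rewrite (le_trans (gauge_ge_coord mu i))// mu0 mulr0.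
Qed.

Lemma gaugeD mu nu : gauge (mu + nu) <= gauge mu + gauge nu.
Proof.
apply/ler_addgt0Pr => e e0.
have e2 : 0 < e / 2 by rewrite divr_gt0.
have /gauge_lt[r0 Hr] : gauge mu < gauge mu + e / 2 by rewrite ltrDl.
have /gauge_lt[s0 Hs] : gauge nu < gauge nu + e / 2 by rewrite ltrDl.
have -> : gauge mu + gauge nu + e = (gauge mu + e / 2) + (gauge nu + e / 2).
  by field.
set r := gauge mu + e / 2 in r0 Hr *; set s := gauge nu + e / 2 in s0 Hs *.
have rs0 : 0 < r + s by rewrite addr_gt0.
apply/gauge_le; split => //.
have t01 : 0 <= r / (r + s) <= 1.
  apply/andP; split; first by rewrite divr_ge0// ltW.
  by rewrite ler_pdivrMr// mul1r lerDl ltW.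
have -> : n%:R * chi 1 = r / (r + s) * (n%:R * chi 1) +
    (1 - r / (r + s)) * (n%:R * chi 1) by ring.
apply: (@le_trans _ _ (r / (r + s) * \sum_i chi (r^-1 * mu 0 i) +
    (1 - r / (r + s)) * \sum_i chi (s^-1 * nu 0 i))).
  rewrite !mulr_sumr -big_split/=; apply: ler_sum => i _.
  apply: le_trans (Wplus_convex hchi _ _ t01).
  rewrite le_eqVlt; apply/orP; left; apply/eqP; congr chi; rewrite mxE; field.
  by rewrite !lt0r_neq0.
by apply: lerD; apply: ler_wpM2l => //; case/andP: t01 => // _; rewrite subr_ge0.
Qed.

Lemma gaugeN mu : gauge (- mu) = gauge mu.
Proof.
have E r : \sum_i chi (r^-1 * (- mu) 0 i) = \sum_i chi (r^-1 * mu 0 i).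
  by apply: eq_bigr => i _; rewrite mxE mulrN (WplusN hchi).
by rewrite /gauge; congr inf; apply/seteqP; split => r [r0]; split;
  rewrite // ?E// -E.
Qed.

Lemma gaugeZ_le c mu : 0 <= c -> gauge (c *: mu) <= c * gauge mu.
Proof.
move=> c0; apply/ler_addgt0Pr => e e0; have [->|cn0] := eqVneq c 0.
  rewrite scale0r mul0r add0r gauge_le_sup ?ltW// => i.
  by rewrite mxE normr0 ltW.
have cp : 0 < c by rewrite lt_def cn0.
have ec0 : 0 < e / c by rewrite divr_gt0.
have /gauge_lt[r0 H] : gauge mu < gauge mu + e / c by rewrite ltrDl.
apply: gauge_le; have -> : c * gauge mu + e = c * (gauge mu + e / c) by field.
split; first by rewrite mulr_gt0.
under eq_bigr do rewrite mxE invfM mulrACA mulVf// mul1r; exact: H.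
Qed.

Lemma gauge0 : gauge 0 = 0.
Proof.
apply/eqP; rewrite eq_le gauge_ge0 andbT gauge_le_sup// => i.
by rewrite mxE normr0.
Qed.

Lemma gaugeZ c mu : gauge (c *: mu) = `|c| * gauge mu.
Proof.
wlog c0 : c / 0 <= c.
  move=> H; have [/H//|c0] := leP 0 c.
  by rewrite -gaugeN -scaleNr H ?normrN// oppr_ge0 ltW.
rewrite ger0_norm//; apply/eqP; rewrite eq_le gaugeZ_le//=.
have [->|cn0] := eqVneq c 0; first by rewrite mul0r gauge_ge0.
have cp : 0 < c by rewrite lt_def cn0.
rewrite -ler_pdivlMl//.
have := @gaugeZ_le c^-1 (c *: mu).
by rewrite scalerA mulVf// scale1r invr_ge0; apply.
Qed.

(** Jensen's inequality uses the row sums; after exchanging the two sums, the column sums bound what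
    remains. Every comparison of norms at different points or in different bases reduces to this. *)
Lemma gauge_substochastic (P : 'I_n -> 'I_n -> R) mu nu :
  (forall i j, 0 <= P i j) -> (forall i, \sum_j P i j <= 1) ->
  (forall j, \sum_i P i j <= 1) ->
  (forall i, nu 0 i = \sum_j P i j * mu 0 j) -> gauge nu <= gauge mu.
Proof.
move=> P0 Prow Pcol nuE; apply/ler_addgt0Pr => e e0.
have /gauge_lt[r0 H] : gauge mu < gauge mu + e by rewrite ltrDl.
apply: gauge_le; split => //; set r := gauge mu + e in r0 H *.
apply: (@le_trans _ _ (\sum_i \sum_j P i j * chi (r^-1 * mu 0 j))).
  apply: ler_sum => i _; rewrite nuE mulr_sumr.
  under [X in chi X]eq_bigr do rewrite mulrCA.
  exact: (Wplus_jensen hchi (fun j => r^-1 * mu 0 j) (P0 i) (Prow i)).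
rewrite exchange_big/=; apply: le_trans H; apply: ler_sum => j _.
by rewrite -mulr_suml ler_piMl// (Wplus_ge0 hchi).
Qed.

End Gauge.

(** * Hermitian matrices *)

Section Adjoint.
Local Open Scope sesquilinear_scope.
Local Open Scope complex_scope.
Variables (R : realType).
Local Notation C := R[i].

Lemma adjmxM m n p (A : 'M[C]_(m, n)) (B : 'M[C]_(n, p)) :
  (A *m B)^t* = B^t* *m A^t*.
Proof. by rewrite trmx_mul map_mxM. Qed.

Lemma adjmxD m n (A B : 'M[C]_(m, n)) : (A + B)^t* = A^t* + B^t*.
Proof. by rewrite linearD/= map_mxD. Qed.

Lemma adjmxB m n (A B : 'M[C]_(m, n)) : (A - B)^t* = A^t* - B^t*.
Proof. by rewrite linearB/= map_mxB. Qed.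

Lemma adjmxZ m n (a : R) (A : 'M[C]_(m, n)) : (a%:C *: A)^t* = a%:C *: A^t*.
Proof.
by rewrite linearZ/= map_mxZ; congr (_ *: _); exact: (conjc_real a).
Qed.

Lemma adjmx1 n : (1%:M : 'M[C]_n)^t* = 1%:M.
Proof. by rewrite trmx1 map_mx1. Qed.

Lemma hermsymmxP n (A : 'M[C]_n) : (A \is hermsymmx) <-> A^t* = A.
Proof.
rewrite is_hermitianmxE expr0 scale1r; split => [/eqP <-//|->]; exact: eqxx.
Qed.

Lemma adjmx_unit n (V : 'M[C]_n) : (V^t* \in unitmx) = (V \in unitmx).
Proof. by rewrite map_unitmx unitmx_tr. Qed.

Lemma adjmx_inv n (V : 'M[C]_n) : invmx (V^t*) = (invmx V)^t*.
Proof. by rewrite trmx_inv map_invmx. Qed.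

Lemma conj_norm2 (z : C) : z^*%R * z = (complex.Re z ^+ 2 + complex.Im z ^+ 2)%:C.
Proof. by rewrite mulrC -normCK add_Re2_Im2. Qed.

Definition rdiag n (mu : 'rV[R]_n) : 'M[C]_n := diag_mx (map_mx (real_complex R) mu).

Lemma rdiagE n (mu : 'rV[R]_n) i j : rdiag mu i j = (mu 0 i)%:C *+ (i == j).
Proof. by rewrite !mxE. Qed.

Lemma rdiag_adj n (mu : 'rV[R]_n) : (rdiag mu)^t* = rdiag mu.
Proof.
apply/matrixP => i j; rewrite !mxE eq_sym; case: eqP => [->|_].
  by rewrite !mulr1n; exact: (conjc_real (mu 0 j)).
by rewrite !mulr0n rmorph0.
Qed.

Lemma rdiagM n (mu nu : 'rV[R]_n) :
  rdiag mu *m rdiag nu = rdiag (\row_i (mu 0 i * nu 0 i)).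
Proof.
rewrite mulmx_diag; congr diag_mx; apply/rowP => i.
by rewrite !mxE -rmorphM.
Qed.

Lemma rdiag1 n : rdiag (const_mx 1 : 'rV[R]_n) = 1%:M.
Proof. by rewrite /rdiag map_const_mx rmorph1 diag_const_mx. Qed.

Lemma rdiagZ n (a : R) (mu : 'rV[R]_n) : a%:C *: rdiag mu = rdiag (a *: mu).
Proof.
rewrite /rdiag -linearZ/=; congr diag_mx; apply/rowP => i.
by rewrite !mxE rmorphM.
Qed.

Lemma mulmx_rdiagE m n (A : 'M[C]_(m, n)) (mu : 'rV[R]_n) i j :
  (A *m rdiag mu) i j = A i j * (mu 0 j)%:C.
Proof. by rewrite mul_mx_diag !mxE. Qed.

Lemma rdiag_mulmxE m n (A : 'M[C]_(n, m)) (mu : 'rV[R]_n) i j :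
  (rdiag mu *m A) i j = (mu 0 i)%:C * A i j.
Proof. by rewrite mul_diag_mx !mxE. Qed.

Definition norm2 (z : C) : R := complex.Re z ^+ 2 + complex.Im z ^+ 2.

Lemma norm2_ge0 z : 0 <= norm2 z. Proof. by rewrite addr_ge0 ?sqr_ge0. Qed.

Lemma norm2J (z : C) : norm2 z^*%R = norm2 z.
Proof. by case: z => a b; rewrite /norm2/= sqrrN. Qed.

(** For unitary [T] the numbers [norm2 (T j i)], with [j] varying, form the spectral measure at the
    i-th basis vector. They are the entries of all the substochastic matrices below. *)
Lemma diag_congruence n m (T : 'M[C]_(n, m)) (mu : 'rV[R]_n) i :
  (T^t* *m rdiag mu *m T) i i = (\sum_j norm2 (T j i) * mu 0 j)%:C.
Proof.
rewrite mxE rmorph_sum; apply: eq_bigr => j _.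
by rewrite mulmx_rdiagE !mxE rmorphM mulrAC conj_norm2.
Qed.

Lemma diag_adjmul n m (T : 'M[C]_(n, m)) i :
  (T^t* *m T) i i = (\sum_j norm2 (T j i))%:C.
Proof.
have := diag_congruence T (const_mx 1) i; rewrite rdiag1 mulmx1 => ->.
by congr (_%:C); apply: eq_bigr => j _; rewrite mxE mulr1.
Qed.

(** The real part makes the form real valued for every matrix, so that forms are compared in [R];
    for Hermitian [A] nothing is lost. *)
Definition qform n (A : 'M[C]_n) (w : 'cV[C]_n) : R :=
  complex.Re ((w^t* *m A *m w) 0 0).

Lemma qform_congruence n (V A : 'M[C]_n) (w : 'cV[C]_n) :
  qform (V^t* *m A *m V) w = qform A (V *m w).
Proof. by rewrite /qform adjmxM !mulmxA. Qed.

Lemma qform_rdiag n (mu : 'rV[R]_n) w :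
  qform (rdiag mu) w = \sum_j norm2 (w j 0) * mu 0 j.
Proof. by rewrite /qform diag_congruence. Qed.

Lemma qform1 n (w : 'cV[C]_n) : qform 1%:M w = \sum_j norm2 (w j 0).
Proof. by rewrite /qform mulmx1 diag_adjmul. Qed.

Lemma ReD (x y : C) : complex.Re (x + y) = complex.Re x + complex.Re y.
Proof. by case: x y => [a b] [c d]. Qed.

Lemma ImD (x y : C) : complex.Im (x + y) = complex.Im x + complex.Im y.
Proof. by case: x y => [a b] [c d]. Qed.

Lemma ReN (x : C) : complex.Re (- x) = - complex.Re x.
Proof. by case: x. Qed.

Lemma ImN (x : C) : complex.Im (- x) = - complex.Im x.
Proof. by case: x. Qed.

Lemma ReZ (a : R) (x : C) : complex.Re (a%:C * x) = a * complex.Re x.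
Proof. by case: x => b c; rewrite /= mul0r subr0. Qed.

Lemma ImZ (a : R) (x : C) : complex.Im (a%:C * x) = a * complex.Im x.
Proof. by case: x => b c; rewrite /= mul0r addr0. Qed.

Lemma qformD n (A B : 'M[C]_n) w : qform (A + B) w = qform A w + qform B w.
Proof. by rewrite /qform mulmxDr mulmxDl mxE ReD. Qed.

Lemma qform_delta n (A : 'M[C]_n) i :
  qform A (delta_mx i 0) = complex.Re (A i i).
Proof.
rewrite /qform; congr complex.Re.
rewrite trmx_delta map_delta_mx -mulmxA -rowE !mxE.
rewrite (bigD1 i)//= !mxE !eqxx/= mulr1 big1 ?addr0// => j ji.
by rewrite !mxE (negPf ji) mulr0.
Qed.

End Adjoint.

(** * Simultaneous diagonalization and the functional calculus *)

Section SimultaneousDiagonalization.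
Local Open Scope sesquilinear_scope.
Local Open Scope complex_scope.
Variables (R : realType) (n : nat).
Local Notation M := 'M[R[i]]_n.
Implicit Types (x y phi V : M) (mu : 'rV[R]_n).

Lemma posdefmx_adj x : posdefmx x -> x^t* = x.
Proof. by case=> /hermsymmxP. Qed.

Lemma posdefmx_qform_gt0 x w : posdefmx x -> w != 0 -> 0 < qform x w.
Proof. by case=> _ H /H; rewrite ltcE => /andP[]. Qed.

Lemma posdefmx_qform_ge0 x w : posdefmx x -> 0 <= qform x w.
Proof.
have [->|w0] := eqVneq w 0; first by rewrite /qform mulmx0 mxE.
by move=> px; exact/ltW/posdefmx_qform_gt0.
Qed.

Lemma herm_qform_real phi (w : 'cV[R[i]]_n) : phi^t* = phi ->
  (w^t* *m phi *m w) 0 0 = (qform phi w)%:C.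
Proof.
move=> H; set z := (_ *m w) 0 0.
have zJ : z^*%R = z.
  rewrite /z -[RHS]mulr1n -[LHS]mulr1n.
  have : (w^t* *m phi *m w)^t* = w^t* *m phi *m w.
    by rewrite !adjmxM trmxCK H mulmxA.
  by move=> /matrixP/(_ 0 0); rewrite !mxE.
rewrite /qform -/z; move: zJ; case: z => a b [] /eqP.
rewrite eq_sym -subr_eq0 opprK -mulr2n mulrn_eq0/= => /eqP ->//.
Qed.

Lemma posdefmxP x : x^t* = x -> (forall w, w != 0 -> 0 < qform x w) ->
  posdefmx x.
Proof.
move=> H q0; split; first exact/hermsymmxP.
by move=> w /q0 qw; rewrite herm_qform_real// ltcR.
Qed.

Lemma herm_diag phi : phi^t* = phi ->
  exists (U : M) mu, U^t* *m U = 1%:M /\ U^t* *m phi *m U = rdiag mu.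
Proof.
move=> H; have /hermsymmxP Hs := H.
have /hermitian_normalmx/orthomx_spectralP E := Hs.
have Dreal := hermitian_spectral_diag_real Hs.
set P := spectralmx phi in E; set D := spectral_diag phi in E Dreal.
have Pu : P \is unitarymx := spectral_unitarymx phi.
have /unitarymxP PPt := Pu.
exists (P^t*), (map_mx (@complex.Re R) D); rewrite trmxCK; split => //.
rewrite -[X in P *m X](_ : P^t* *m diag_mx D *m P = _); last first.
  by rewrite [RHS]E invmx_unitary.
rewrite !mulmxA PPt mul1mx -mulmxA PPt mulmx1; congr diag_mx.
apply/rowP => i; rewrite !mxE; apply/esym/RRe_real.
exact: (mxOverP Dreal).
Qed.

(** The columns of [V] form an [x]-orthonormal basis of eigenvectors of [invmx x *m phi], with
    eigenvalues [mu]. *)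
Definition sdiag x phi V mu :=
  [/\ V \in unitmx, V^t* *m x *m V = 1%:M & V^t* *m phi *m V = rdiag mu].

Lemma sdiag_exists x phi : posdefmx x -> phi^t* = phi ->
  exists V mu, sdiag x phi V mu.
Proof.
move=> px Hphi; have [U [d [UU Ux]]] := herm_diag (posdefmx_adj px).
have d0 i : 0 < d 0 i.
  have := qform_congruence U x (delta_mx i 0); rewrite Ux qform_delta.
  rewrite rdiagE eqxx /= => ->; apply: posdefmx_qform_gt0 => //.
  apply/eqP => /(congr1 (mulmx (U^t*))); rewrite mulmxA UU mul1mx mulmx0.
  by move=> /matrixP/(_ i 0); rewrite !mxE !eqxx => /eqP; rewrite oner_eq0.
(* [W] is [U] times the inverse square root of the eigenvalues of [x]. A unitary [Q] then
   diagonalizes the second form without disturbing the first. *)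
have [W WW] : exists W : M, W^t* *m x *m W = 1%:M.
  exists (U *m rdiag (\row_i (Num.sqrt (d 0 i))^-1)); rewrite adjmxM rdiag_adj -2!mulmxA.
  rewrite (mulmxA x) (mulmxA (U^t*)) (mulmxA (U^t*)).
  rewrite Ux !rdiagM -rdiag1; congr rdiag; apply/rowP => i; rewrite !mxE.
  have sd : Num.sqrt (d 0 i) != 0 by rewrite sqrtr_eq0 -ltNge.
  have ds := sqr_sqrtr (ltW (d0 i)).
  by move: sd ds; set s := Num.sqrt _ => sd <-;
    rewrite expr2 -mulrA mulfV// mulr1 mulVf.
have [Q [mu [QQ Qphi]]] : exists (Q : M) mu, Q^t* *m Q = 1%:M /\
    Q^t* *m (W^t* *m phi *m W) *m Q = rdiag mu.
  by apply: herm_diag; rewrite !adjmxM trmxCK Hphi mulmxA.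
have Wu : W \in unitmx by case/mulmx1_unit: WW.
have Qu : Q \in unitmx by case/mulmx1_unit: QQ.
exists (W *m Q), mu; split.
- by rewrite unitmx_mul Wu.
- by rewrite adjmxM -!mulmxA (mulmxA x) (mulmxA (W^t*)) (mulmxA (W^t*)) WW mul1mx.
- by rewrite adjmxM !mulmxA; rewrite !mulmxA in Qphi.
Qed.

Lemma sdiag_inv x phi V mu : sdiag x phi V mu ->
  x \in unitmx /\ invmx x = V *m V^t*.
Proof.
move=> [Vu Vx _]; have H : x *m (V *m V^t*) = 1%:M.
  by rewrite mulmxA; apply: mulmx1C; rewrite mulmxA.
have [xu _] := mulmx1_unit H; split => //.
by rewrite -[RHS](mulKmx xu) H mulmx1.
Qed.

Lemma sdiag_phiE x phi V mu : sdiag x phi V mu ->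
  phi = (invmx V)^t* *m rdiag mu *m invmx V.
Proof.
move=> [Vu _ <-]; rewrite -adjmx_inv !mulmxA mulVmx ?adjmx_unit// mul1mx.
by rewrite mulmxK.
Qed.

Lemma sdiag_xE x phi V mu : sdiag x phi V mu -> x = (invmx V)^t* *m invmx V.
Proof.
move=> [Vu Vx _]; rewrite -[X in _ = _ *m X]mul1mx -Vx -adjmx_inv.
by rewrite !mulmxA mulmxK// mulVmx ?adjmx_unit// mul1mx.
Qed.

Lemma sdiag_mulE x phi V mu : sdiag x phi V mu ->
  invmx x *m phi = V *m rdiag mu *m invmx V.
Proof.
move=> S; have [_ ->] := sdiag_inv S; rewrite (sdiag_phiE S).
case: S => Vu _ _.
by rewrite -!mulmxA (mulmxA (V^t*)) -adjmxM (mulVmx Vu) adjmx1 mul1mx mulmxA.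
Qed.

(** The functional calculus does not depend on the diagonalization. The intertwiner [W] satisfies
    [W i j * mu j = nu i * W i j], so a nonzero entry forces [mu j = nu i], hence equal values of
    [f]. *)
Lemma rdiag_similar_map (f : R -> R) (U V : M) mu nu :
  U \in unitmx -> V \in unitmx ->
  U *m rdiag mu *m invmx U = V *m rdiag nu *m invmx V ->
  U *m rdiag (map_mx f mu) *m invmx U = V *m rdiag (map_mx f nu) *m invmx V.
Proof.
move=> Uu Vu E; have := congr1 (fun A => invmx V *m (A *m U)) E.
rewrite -!mulmxA (mulVmx Uu) mulmx1 (mulKmx Vu) (mulmxA (invmx V)).
have : U = V *m (invmx V *m U) by rewrite mulKVmx.
move: (invmx V *m U) => W UE EW.
have FW : W *m rdiag (map_mx f mu) = rdiag (map_mx f nu) *m W.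
  apply/matrixP => i j; move/matrixP/(_ i j): EW.
  rewrite mulmx_rdiagE rdiag_mulmxE [RHS]mulrC => /eqP.
  rewrite -subr_eq0 -mulrBr mulf_eq0 subr_eq0 => /orP[/eqP H|/eqP/complexI H].
    by rewrite mulmx_rdiagE rdiag_mulmxE H mul0r mulr0.
  by rewrite mulmx_rdiagE rdiag_mulmxE !mxE H mulrC.
apply: (can_inj (mulmxK Uu)) => /=.
by rewrite -!mulmxA (mulVmx Uu) mulmx1 {1 2}UE (mulKmx Vu) -mulmxA FW.
Qed.

Lemma mxfun_rdiag (f : R -> R) (U : M) mu : U \in unitmx ->
  mxfun f (U *m rdiag mu *m invmx U) = U *m rdiag (map_mx f mu) *m invmx U.
Proof.
move=> Uu; have rdiag_mapE (nu : 'rV[R]_n) :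
    rdiag (map_mx f nu) = diag_mx (map_mx (fun a => (f a)%:C) nu).
  by congr diag_mx; apply/rowP => i; rewrite !mxE.
rewrite /mxfun; apply: xget_unique.
  by exists U, mu; split => //; rewrite rdiag_mapE.
move=> B [V [nu [Vu E ->]]]; rewrite -rdiag_mapE.
by apply: rdiag_similar_map => //; rewrite -[RHS]E.
Qed.

Lemma orlicz_norm_gauge chi x phi V mu : (0 < n)%N -> sdiag x phi V mu ->
  orlicz_norm chi x phi = gauge chi mu.
Proof.
move=> n0 S; rewrite /orlicz_norm (sdiag_mulE S); case: S => Vu _ _.
congr inf; apply/seteqP.
suff E r : (n%:R^-1 * \tr (mxfun chi ((r^-1)%:C *: (V *m rdiag mu *m invmx V)))
    <= (chi 1)%:C) = (\sum_i chi (r^-1 * mu 0 i) <= n%:R * chi 1).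
  by split => r [r0 H]; split => //; rewrite ?E// -E.
rewrite scalemxAl scalemxAr rdiagZ mxfun_rdiag// mxtrace_mulC mulKmx//.
rewrite mxtrace_diag; under eq_bigr do rewrite !mxE.
rewrite -rmorph_sum -(rmorph_nat (real_complex R)) -fmorphV -rmorphM/= lecR.
by rewrite mulrC ler_pdivrMr ?ltr0n// mulrC.
Qed.

(** * The norm at a point and its dependence on the point *)

Section Norm.
Variables (p : R) (chi : R -> R).
Hypotheses (hn : (0 < n)%N) (hchi : Wplus p chi).

Lemma sdiag_change x phi V mu W : sdiag x phi V mu ->
  exists T : M, [/\ W = V *m T, W^t* *m x *m W = T^t* *m T &
    W^t* *m phi *m W = T^t* *m rdiag mu *m T].
Proof.
move=> [Vu Vx Vphi]; exists (invmx V *m W).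
have WE : W = V *m (invmx V *m W) by rewrite mulKVmx.
move: (invmx V *m W) WE => T ->.
split => //; rewrite adjmxM -!mulmxA.
  by rewrite (mulmxA x) (mulmxA (V^t*)) (mulmxA (V^t*)) Vx mul1mx.
by rewrite (mulmxA phi) (mulmxA (V^t*)) (mulmxA (V^t*)) Vphi mulmxA.
Qed.

Lemma unitary_col (T : M) i : T^t* *m T = 1%:M -> \sum_j norm2 (T j i) = 1.
Proof. by move=> TT; have := diag_adjmul T i; rewrite TT mxE eqxx => /complexI. Qed.

Lemma unitary_row (T : M) j : T^t* *m T = 1%:M -> \sum_i norm2 (T j i) = 1.
Proof.
move=> TT; have := @unitary_col (T^t*) j; rewrite trmxCK (mulmx1C TT) => <- //.
by apply: eq_bigr => i _; rewrite !mxE norm2J.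
Qed.

(** Squared column norms of [T^t* *m rdiag mu *m T] are thereby the second moments of [mu] under the
    spectral measures. *)
Lemma unitary_gram (T : M) mu : T *m T^t* = 1%:M ->
  (T^t* *m rdiag mu *m T)^t* *m (T^t* *m rdiag mu *m T) =
  T^t* *m rdiag (\row_j (mu 0 j ^+ 2)) *m T.
Proof.
move=> TT; have -> : (T^t* *m rdiag mu *m T)^t* = T^t* *m rdiag mu *m T.
  by rewrite !adjmxM trmxCK rdiag_adj mulmxA.
rewrite -!mulmxA (mulmxA T) TT mul1mx (mulmxA (rdiag mu)) rdiagM.
by [].
Qed.

Lemma herm_congruence (V A : M) : A^t* = A -> (V^t* *m A *m V)^t* = V^t* *m A *m V.
Proof. by move=> HA; rewrite !adjmxM trmxCK HA mulmxA. Qed.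

Lemma herm_diagE (V A : M) i : A^t* = A ->
  (V^t* *m A *m V) i i = (qform A (V *m delta_mx i 0))%:C.
Proof.
move=> HA; rewrite -qform_congruence qform_delta.
have /matrixP/(_ i i) := herm_congruence V HA; rewrite !mxE.
set z := \sum_(_ | _) _; case: z => a b [] /eqP.
by rewrite eq_sym -subr_eq0 opprK -mulr2n mulrn_eq0/= => /eqP ->.
Qed.

(* The compression of phi to a y-orthonormal basis has diagonal P mu with
   P_ij = |T_ji|^2, and P/c is doubly substochastic when T^* T <= c: this
   handles the change of base point. *)
Lemma orlicz_norm_le_base c x y phi : posdefmx x -> posdefmx y ->
  phi^t* = phi -> 0 < c -> (forall w, qform x w <= c * qform y w) ->
  orlicz_norm chi y phi <= c * orlicz_norm chi x phi.
Proof.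
move=> px py Hphi c0 xy.
have [V [mu S]] := sdiag_exists px Hphi.
have [W [nu S']] := sdiag_exists py Hphi.
rewrite (orlicz_norm_gauge _ hn S) (orlicz_norm_gauge _ hn S').
have [T [WE Wx Wphi]] := sdiag_change W S; have [Wu Wy Wphi'] := S'.
have nuE i : nu 0 i = \sum_j norm2 (T j i) * mu 0 j.
  have := diag_congruence T mu i; rewrite -Wphi Wphi'.
  by rewrite rdiagE eqxx mulr1n => /complexI.
have TTle w : qform (T^t* *m T) w <= c * \sum_j norm2 (w j 0).
  by rewrite -Wx qform_congruence -qform1 -Wy qform_congruence.
have colT i : \sum_j norm2 (T j i) <= c.
  have := TTle (delta_mx i 0).
  rewrite qform_delta diag_adjmul/= => /le_trans; apply.
  by rewrite -qform1 qform_delta mxE eqxx/= mulr1.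
(* Row sums are not diagonal entries of [T^t* *m T]. Testing the form at the conjugate [w] of row
   [j], whose image has j-th coordinate [q], gives [q ^ 2 <= c * q]. *)
have rowT j : \sum_i norm2 (T j i) <= c.
  set q := \sum_i _; pose w := (row j T)^t*.
  have qE : \sum_i norm2 (w i 0) = q.
    by apply: eq_bigr => i _; rewrite !mxE norm2J.
  have := TTle w; rewrite qE.
  have -> : qform (T^t* *m T) w = \sum_k norm2 ((T *m w) k 0).
    by rewrite -qform1 -qform_congruence mulmx1.
  have Tw : norm2 ((T *m w) j 0) = q ^+ 2.
    have -> : (T *m w) j 0 = q%:C.
      rewrite mxE rmorph_sum; apply: eq_bigr => i _; rewrite !mxE mulrC.
      exact: conj_norm2.
    by rewrite /norm2/= expr0n addr0.
  rewrite (bigD1 j)//= Tw => H.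
  have q0 : 0 <= q by apply: sumr_ge0 => i _; exact: norm2_ge0.
  have [->|qn0] := eqVneq q 0; first exact: ltW.
  have qp : 0 < q by rewrite lt_def qn0.
  rewrite -(ler_pM2r qp) -expr2; apply: le_trans H.
  by rewrite lerDl sumr_ge0// => k _; exact: norm2_ge0.
have <- : gauge chi (c *: mu) = c * gauge chi mu.
  by rewrite (gaugeZ hchi) gtr0_norm.
apply: (gauge_substochastic hchi (P := fun i j => c^-1 * norm2 (T j i))).
- by move=> i j; rewrite mulr_ge0 ?norm2_ge0// invr_ge0 ltW.
- by move=> i; rewrite -mulr_sumr mulrC ler_pdivrMr// mul1r.
- by move=> i; rewrite -mulr_sumr mulrC ler_pdivrMr// mul1r.
- move=> i; rewrite nuE; apply: eq_bigr => j _; rewrite mxE; field.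
  exact: lt0r_neq0.
Qed.

(* Schur: the diagonal of phi in any x-orthonormal basis is majorized by the
   eigenvalues. *)
Lemma gauge_diag_le x phi (W : M) (nu : 'rV[R]_n) : posdefmx x -> phi^t* = phi ->
  W^t* *m x *m W = 1%:M ->
  (forall i, (W^t* *m phi *m W) i i = (nu 0 i)%:C) ->
  gauge chi nu <= orlicz_norm chi x phi.
Proof.
move=> px Hphi Wx nuE.
have [V [mu S]] := sdiag_exists px Hphi; rewrite (orlicz_norm_gauge _ hn S).
have [T [WE]] := sdiag_change W S; rewrite Wx => /esym TT Wphi.
apply: (gauge_substochastic hchi (P := fun i j => norm2 (T j i))).
- by move=> i j; exact: norm2_ge0.
- by move=> i; rewrite unitary_col.
- by move=> j; rewrite unitary_row.
by move=> i; apply: complexI; rewrite -nuE -diag_congruence -Wphi.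
Qed.

Lemma orlicz_norm_ge0 x phi : 0 <= orlicz_norm chi x phi.
Proof.
rewrite /orlicz_norm; set A := (X in inf X).
have [->|S0] := eqVneq A set0; first by rewrite inf0.
apply: lb_le_inf; first exact/set0P.
by move=> r [/ltW].
Qed.

(** The two matrices need not be diagonal in a common basis. In an eigenbasis of the sum, its
    eigenvalues are the sum of the two diagonals, and Schur's theorem bounds the gauge of each
    diagonal. *)
Lemma orlicz_normD x phi psi : posdefmx x -> phi^t* = phi -> psi^t* = psi ->
  orlicz_norm chi x (phi + psi) <= orlicz_norm chi x phi + orlicz_norm chi x psi.
Proof.
move=> px Hphi Hpsi.
have Hs : (phi + psi)^t* = phi + psi by rewrite adjmxD Hphi Hpsi.
have [V [mu S]] := sdiag_exists px Hs; rewrite (orlicz_norm_gauge _ hn S).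
case: S => Vu Vx Vs.
pose d a : 'rV[R]_n := \row_i qform a (V *m delta_mx i 0).
have -> : mu = d phi + d psi.
  apply/rowP => i; rewrite !mxE -qformD; apply: complexI.
  by rewrite -herm_diagE// Vs rdiagE eqxx.
apply: le_trans (gaugeD hchi _ _) _; apply: lerD;
  apply: gauge_diag_le => //; try exact: Vx; by move=> i; rewrite herm_diagE// mxE.
Qed.

Lemma sdiagZ a x phi V mu : sdiag x phi V mu -> sdiag x (a%:C *: phi) V (a *: mu).
Proof.
by move=> [Vu Vx Vphi]; split => //; rewrite -scalemxAr -scalemxAl Vphi rdiagZ.
Qed.

Lemma orlicz_normZ a x phi : posdefmx x -> phi^t* = phi ->
  orlicz_norm chi x (a%:C *: phi) = `|a| * orlicz_norm chi x phi.
Proof.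
move=> px Hphi; have [V [mu S]] := sdiag_exists px Hphi.
rewrite (orlicz_norm_gauge _ hn S) (orlicz_norm_gauge _ hn (sdiagZ a S)).
exact: (gaugeZ hchi).
Qed.

Lemma sdiag_coef x phi V mu i : sdiag x phi V mu ->
  qform x (V *m delta_mx i 0) = 1 /\ qform phi (V *m delta_mx i 0) = mu 0 i.
Proof.
move=> [_ Vx Vphi]; rewrite -!qform_congruence Vx Vphi !qform_delta.
by rewrite rdiagE mxE eqxx.
Qed.

Lemma orlicz_norm_le e x phi : posdefmx x -> phi^t* = phi -> 0 <= e ->
  (forall w, `|qform phi w| <= e * qform x w) -> orlicz_norm chi x phi <= e.
Proof.
move=> px Hphi e0 H; have [V [mu S]] := sdiag_exists px Hphi.
rewrite (orlicz_norm_gauge _ hn S) (gauge_le_sup hchi)// => i.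
by have [Vx <-] := sdiag_coef i S; apply: (le_trans (H _)); rewrite Vx mulr1.
Qed.

(** The matrix inside is the initial velocity of [x exp (t log (x^-1 y))], the geodesic from [x] to
    [y]. *)
Definition log_dist x y := orlicz_norm chi x (x *m mxfun (@ln R) (invmx x *m y)).

Lemma log_distE x y V mu : sdiag x y V mu ->
  log_dist x y = gauge chi (map_mx (@ln R) mu).
Proof.
move=> S; rewrite /log_dist (sdiag_mulE S); case: S => Vu Vx _.
rewrite mxfun_rdiag//; apply: (orlicz_norm_gauge chi (V := V)) => //; split => //.
by rewrite !mulmxA Vx mul1mx mulmxKV.
Qed.

(** The bound [ln a - ln b <= (a - b) / b], used in both orders, places the error between
    [- (m - l)^2 / (l * m)] and 0. *)
Lemma ln_taylor_le (c l m : R) : 0 < c -> c <= l -> c <= m ->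
  `|ln m - ln l - (m - l) / l| <= ((m - l) / c) ^+ 2.
Proof.
move=> c0 cl cm; have l0 := lt_le_trans c0 cl; have m0 := lt_le_trans c0 cm.
have ln_sub (a b : R) : 0 < a -> 0 < b -> ln a - ln b <= (a - b) / b.
  move=> a0 b0; rewrite -ln_div ?posrE//.
  have -> : a / b = 1 + (a - b) / b by field; rewrite lt0r_neq0.
  apply: le_ln1Dx.
  rewrite -(ltrD2l 1) subrr; have -> : 1 + (a - b) / b = a / b.
    by field; rewrite lt0r_neq0.
  exact: divr_gt0.
have H1 := ln_sub _ _ m0 l0; have H2 := ln_sub _ _ l0 m0.
have H3 : (m - l) / l - (m - l) / m = (m - l) ^+ 2 / (l * m).
  by field; rewrite !lt0r_neq0.
have H4 : (m - l) ^+ 2 / (l * m) <= ((m - l) / c) ^+ 2.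
  rewrite expr_div_n ler_wpM2l ?sqr_ge0// lef_pV2 ?posrE ?exprn_gt0 ?mulr_gt0//.
  by rewrite expr2 ler_pM// ltW.
have H5 : (l - m) / m = - ((m - l) / m) by rewrite -mulNr opprB.
rewrite ler_norml; apply/andP; split; lra.
Qed.

(** The constants are relative to [x], so they bound eigenvalues directly: [c] those of [y] and [z]
    from below, [k] those of [z - y] in absolute value. The norm sits at [y], the point whose
    distance is bounded from above, whichever of the two comes first on a curve. *)
Lemma log_dist_step c k x y z : posdefmx x -> posdefmx y -> posdefmx z ->
  0 < c -> (forall w, c * qform x w <= qform y w) ->
  (forall w, c * qform x w <= qform z w) ->
  0 <= k -> (forall w, `|qform (z - y) w| <= k * qform x w) ->
  log_dist x y <= log_dist x z + orlicz_norm chi y (z - y) + (k / c) ^+ 2.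
Proof.
move=> px py pz c0 cy cz k0 zyk.
have Hy := posdefmx_adj py; have Hz := posdefmx_adj pz.
have Hzy : (z - y)^t* = z - y by rewrite adjmxB Hz Hy.
have [V [la Sy]] := sdiag_exists px Hy.
have [W [mu Sz]] := sdiag_exists px Hz.
have [U [nu Szy]] := sdiag_exists px Hzy.
have Vx : V^t* *m x *m V = 1%:M by case: Sy.
have Vy : V^t* *m y *m V = rdiag la by case: Sy.
rewrite (log_distE Sy) (log_distE Sz).
have la_c i : c <= la 0 i.
  by have [xi <-] := sdiag_coef i Sy; rewrite -[c]mulr1 -xi.
have mu_c i : c <= mu 0 i.
  by have [xi <-] := sdiag_coef i Sz; rewrite -[c]mulr1 -xi.
have nu_k i : `|nu 0 i| <= k.
  by have [xi <-] := sdiag_coef i Szy; rewrite -[k]mulr1 -xi.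
have la0 i : 0 < la 0 i := lt_le_trans c0 (la_c i).
have [T [_ + Vz]] := sdiag_change V Sz; rewrite Vx => /esym TT.
have [S [_ + Vzy]] := sdiag_change V Szy; rewrite Vx => /esym SS.
have TT' := mulmx1C TT; have SS' := mulmx1C SS.
pose e i := qform (z - y) (V *m delta_mx i 0).
(* First moment about [la 0 i] of the spectral measure of [z] at the i-th vector of the eigenbasis
   of [y]. *)
have eE i : e i = \sum_j norm2 (T j i) * (mu 0 j - la 0 i).
  under eq_bigr do rewrite mulrBr.
  rewrite sumrB -mulr_suml unitary_col// mul1r; apply: complexI.
  rewrite rmorphB/= -diag_congruence -Vz -herm_diagE// mulmxBr mulmxBl Vy.
  by rewrite [LHS]mxE [in X in _ + X]mxE rdiagE eqxx.
(* The second moment is the squared norm of column [i] of [V^t* *m z *m V - la_i]. Since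
   [V^t* *m y *m V] is diagonal with i-th entry [la_i], this is also column [i] of the matrix of
   [z - y], whose eigenvalues are at most [k]. *)
have e2 i : \sum_j norm2 (T j i) * (mu 0 j - la 0 i) ^+ 2 <= k ^+ 2.
  pose G := T^t* *m rdiag (mu - const_mx (la 0 i)) *m T.
  have GE : G = V^t* *m z *m V - (la 0 i)%:C%:M.
    rewrite /G Vz /rdiag map_mxB linearB/= map_const_mx diag_const_mx.
    by rewrite mulmxBr mulmxBl -scalemx1 -scalemxAr mulmx1 -scalemxAl TT.
  have -> : \sum_j norm2 (T j i) * (mu 0 j - la 0 i) ^+ 2 =
      \sum_j norm2 (G j i).
    apply: complexI; rewrite -diag_adjmul unitary_gram// diag_congruence.
    by congr (_%:C); apply: eq_bigr => j _; rewrite !mxE.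
  have -> : \sum_j norm2 (G j i) = \sum_j norm2 ((V^t* *m (z - y) *m V) j i).
    apply: eq_bigr => j _; congr norm2; rewrite GE mulmxBr mulmxBl Vy.
    rewrite [LHS]mxE [RHS]mxE; congr (_ + _).
    rewrite [LHS]mxE [RHS]mxE rdiagE mxE; congr (- _).
    by case: eqP => [->|].
  have -> : \sum_j norm2 ((V^t* *m (z - y) *m V) j i) =
      \sum_j norm2 (S j i) * (nu 0 j ^+ 2).
    apply: complexI; rewrite -diag_adjmul Vzy unitary_gram// diag_congruence.
    by congr (_%:C); apply: eq_bigr => j _; rewrite mxE.
  rewrite -[leRHS]mul1r -(unitary_col i SS) mulr_suml; apply: ler_sum => j _.
  rewrite ler_wpM2l ?norm2_ge0// -real_normK ?num_real//.
  by rewrite lerXn2r// nnegrE.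
(* [d] is the diagonal of the logarithm of [z], [a] the first-order change of the logarithms, and
   [b] the remainder. *)
pose d : 'rV[R]_n := \row_i \sum_j norm2 (T j i) * ln (mu 0 j).
pose a : 'rV[R]_n := \row_i (e i / la 0 i).
pose b : 'rV[R]_n := map_mx (@ln R) la - d + a.
have -> : map_mx (@ln R) la = d - a + b.
  by rewrite /b addrC -addrA [a + _]addrC subrK subrK.
have gd : gauge chi d <= gauge chi (map_mx (@ln R) mu).
  apply: (gauge_substochastic hchi (P := fun i j => norm2 (T j i))).
  - by move=> i j; exact: norm2_ge0.
  - by move=> i; rewrite unitary_col.
  - by move=> j; rewrite unitary_row.
  - by move=> i; rewrite mxE; apply: eq_bigr => j _; rewrite mxE.
(* Dividing the columns of [V] by the square roots of [la] gives a [y]-orthonormal basis in which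
   [z - y] has diagonal [e i / la_i]. *)
have ga : gauge chi (- a) <= orlicz_norm chi y (z - y).
  rewrite (gaugeN hchi); pose L : 'rV[R]_n := \row_i (Num.sqrt (la 0 i))^-1.
  have L2 i : L 0 i * L 0 i = (la 0 i)^-1.
    by rewrite mxE -invfM -expr2 sqr_sqrtr// ltW.
  apply: (@gauge_diag_le _ _ (V *m rdiag L)) => //.
    rewrite adjmxM rdiag_adj -!mulmxA (mulmxA y) (mulmxA (V^t*)) (mulmxA (V^t*)) Vy.
    rewrite !rdiagM -rdiag1; congr rdiag; apply/rowP => i; rewrite !mxE.
    have := L2 i; rewrite !mxE => H.
    by rewrite mulrCA H mulfV ?lt0r_neq0.
  move=> i; rewrite adjmxM rdiag_adj -!mulmxA (mulmxA (z - y)) (mulmxA (V^t*)).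
  rewrite (mulmxA (V^t*)) rdiag_mulmxE mulmx_rdiagE herm_diagE// !mxE -/(e i).
  have := L2 i; rewrite !mxE => H.
  by rewrite -!rmorphM/= mulrCA H.
have gb : gauge chi b <= (k / c) ^+ 2.
  apply: (gauge_le_sup hchi); first exact: sqr_ge0.
  move=> i; rewrite !mxE eE -[ln _]mul1r -(unitary_col i TT) !mulr_suml.
  rewrite -sumrB -big_split/=; apply: le_trans (ler_norm_sum _ _ _) _.
  apply: (@le_trans _ _ (\sum_j norm2 (T j i) * ((mu 0 j - la 0 i) / c) ^+ 2)).
    apply: ler_sum => j _; rewrite -mulrBr -mulrA -mulrDr normrM.
    rewrite ger0_norm ?norm2_ge0// ler_wpM2l ?norm2_ge0//.
    have := ln_taylor_le c0 (la_c i) (mu_c j); congr (_ <= _).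
    rewrite -normrN; congr `| _ |; ring.
  under eq_bigr do rewrite expr_div_n mulrA.
  by rewrite -mulr_suml expr_div_n ler_wpM2r// invr_ge0 sqr_ge0.
apply: le_trans (gaugeD hchi _ _) _; apply: lerD gb.
by apply: le_trans (gaugeD hchi _ _) _; apply: lerD.
Qed.

End Norm.

End SimultaneousDiagonalization.

(** * Calculus *)

Section RealFunctions.
Local Open Scope classical_set_scope.
Local Open Scope ring_scope.
Variable R : realType.
Implicit Types (f g m phi : R -> R) (s t : R).

Lemma measurable_lipschitz C m :
  (forall s t, 0 <= s <= 1 -> 0 <= t <= 1 -> `|m s - m t| <= C * `|s - t|) ->
  measurable_fun (`[0, 1]%classic : set R) m.
Proof.
move=> mC; apply: subspace_continuous_measurable_fun => //.
apply/subspace_continuousP => t /=; rewrite in_itv/= => t01.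
apply/cvgrPdist_le => e e0; near=> s.
have s01 : 0 <= s <= 1.
  by have : `[0, 1]%classic s by near: s; apply: withinT; exact: nbhs_filter.
apply: (le_trans (mC _ _ t01 s01)).
have C1 : 0 < `|C| + 1 by rewrite ltr_wpDl.
apply: (@le_trans _ _ ((`|C| + 1) * `|t - s|)).
  by rewrite ler_wpM2r// (le_trans (ler_norm _))// lerDl.
rewrite mulrC -ler_pdivlMr//; near: s.
by apply: cvg_within; move/cvgrPdist_le: (@cvg_id _ (nbhs t)); apply; rewrite divr_gt0.
Unshelve. all: by end_near. Qed.

(* Riemann sums over the uniform partition: a one-sided first-order bound with a
   uniform quadratic error integrates to a global one. *)
Lemma increment_le_integral C m phi :
  (forall t, 0 <= t <= 1 -> 0 <= m t) ->
  (forall s t, 0 <= s <= 1 -> 0 <= t <= 1 -> `|m s - m t| <= C * `|s - t|) ->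
  (forall s t, 0 <= s <= 1 -> 0 <= t <= 1 ->
     phi t - phi s <= `|t - s| * m t + C * (t - s) ^+ 2) ->
  ((phi 1 - phi 0)%:E <= \int[lebesgue_measure]_(t in `[0%R, 1%R]) (m t)%:E)%E.
Proof.
move=> m0 mC phiC.
have C0 : 0 <= C.
  have := mC 0 1; rewrite sub0r normrN1 mulr1 => H.
  by apply: (le_trans (normr_ge0 _) (H _ _)); lra.
have mm : measurable_fun (`[0, 1]%classic : set R) (EFin \o m).
  by apply/measurable_EFinP; exact: measurable_lipschitz mC.
pose I a : \bar R := (\int[lebesgue_measure]_(t in `[0%R, a]) (m t)%:E)%E.
have step (a b : R) : 0 <= a -> a < b -> b <= 1 ->
    (I a + ((b - a) * (m b - C * (b - a)))%:E <= I b)%E.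
  move=> a0 ab b1.
  have bU : `[0, b]%classic = `[0, a]%classic `|` `]a, b]%classic :> set R.
    by rewrite -itv_bndbnd_setU ?bnd_simp// ltW.
  rewrite /I [X in (_ <= integral _ X _)%E]bU ge0_integral_setU//=; first last.
  - apply/disj_setPS => x [/=]; rewrite !in_itv/= => /andP[_ xa] /andP[ax _].
    by move: (le_lt_trans xa ax); rewrite ltxx.
  - move=> x [|]/=; rewrite in_itv/= => /andP[x0 x1]; rewrite lee_fin m0//; lra.
  - apply: measurable_funS mm => //.
    move=> x [|]/=; rewrite !in_itv/= => /andP[x0 x1]; lra.
  apply: leeD => //.
  (* The Lipschitz lower bound for [m] on the cell is truncated at 0, because the comparison of
     integrals is for nonnegative functions. *)
  pose c := Num.max 0 (m b - C * (b - a)).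
  apply: (@le_trans _ _ (\int[lebesgue_measure]_(x in `]a, b]) (cst c%:E) x)%E).
    rewrite integral_cst// [X in (_ * X)%E](@lebesgue_measure_itv R `]a, b]).
    rewrite /= lte_fin ab -EFinB -EFinM lee_fin.
    by rewrite [leRHS]mulrC ler_wpM2l// ?subr_ge0 ?(ltW ab)// le_max lexx orbT.
  apply: ge0_le_integral => //=.
  - by move=> x _; rewrite lee_fin le_max lexx.
  - apply: measurable_funS mm => //.
    by move=> x/=; rewrite !in_itv/= => /andP[x0 x1]; lra.
  - move=> x/=; rewrite in_itv/= => /andP[ax xb]; rewrite lee_fin ge_max m0/=; last lra.
    have b01 : 0 <= b <= 1 by lra.
    have x01 : 0 <= x <= 1 by lra.
    have := mC _ _ b01 x01; rewrite ler_norml => /andP[_].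
    have -> : `|b - x| = b - x by rewrite ger0_norm// subr_ge0.
    have : C * (b - x) <= C * (b - a) by rewrite ler_wpM2l//; lra.
    lra.
(* Each cell costs [C / N.+1 ^ 2] twice: once for the quadratic error of [phi], once for freezing
   [m] at the right end of the cell. *)
have {}step N k : (k <= N.+1)%N ->
    ((phi (k%:R / N.+1%:R) - phi 0)%:E <=
     I (k%:R / N.+1%:R)%R + (2 * C * k%:R / N.+1%:R ^+ 2)%:E)%E.
  have N0 : (0 : R) < N.+1%:R by [].
  elim: k => [_|k IH kN].
    rewrite !mul0r mulr0 mul0r subrr adde0.
    apply: integral_ge0 => t /=; rewrite in_itv/= => t0; rewrite lee_fin m0//; lra.
  have {}IH := IH (ltnW kN).
  set a := k%:R / _ in IH *; set b := k.+1%:R / _.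
  have a0 : 0 <= a by rewrite divr_ge0.
  have ba : b - a = N.+1%:R^-1.
    by rewrite /b /a -mulrBl -natrB// subSnn mul1r.
  have N0' : 0 < (N.+1%:R : R)^-1 by rewrite invr_gt0.
  have ab : a < b by rewrite -subr_gt0 ba.
  have b1 : b <= 1 by rewrite ler_pdivrMr// mul1r ler_nat.
  clearbody a b.
  have := step _ _ a0 ab b1; rewrite ba => H.
  have := phiC a b; rewrite ba ger0_norm ?(ltW N0')// => P.
  have {}P : phi b - phi a <= N.+1%:R^-1 * m b + C * N.+1%:R^-1 ^+ 2 by apply: P; lra.
  apply: (@le_trans _ _ (I a + (2 * C * k%:R / N.+1%:R ^+ 2)%:E +
    (N.+1%:R^-1 * m b + C * N.+1%:R^-1 ^+ 2)%:E)%E).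
    apply: le_trans (leeD IH (lexx _)); rewrite -EFinD lee_fin.
    by move: P; set X := _ + _ * _; clearbody X; lra.
  have -> : (I a + (2 * C * k%:R / N.+1%:R ^+ 2)%:E +
    (N.+1%:R^-1 * m b + C * N.+1%:R^-1 ^+ 2)%:E =
    I a + (N.+1%:R^-1 * (m b - C * N.+1%:R^-1))%:E
      + (2 * C * k.+1%:R / N.+1%:R ^+ 2)%:E)%E.
    have addE (z : \bar R) (x y : R) : (z + x%:E + y%:E = z + (x + y)%:E)%E.
      by rewrite -addeA -EFinD.
    rewrite !addE; apply: (congr1 (fun x : R => I a + x%:E)%E).
    by rewrite -[k.+1]addn1 natrD; field.
  by apply: leeD.
apply/lee_addgt0Pr => e e0.
(* This gives [2 * C / e < N.+1], and the total error over all cells is [2 * C / N.+1]. *)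
pose N := Num.truncn (2 * C / e).
have := step N N.+1 (leqnn _); rewrite divff// => /le_trans; apply.
rewrite leeD2l// lee_fin expr2 invfM mulrA mulfK//.
apply: ltW; rewrite ltr_pdivrMr// [ltRHS]mulrC -ltr_pdivrMr//.
by have /andP[] := truncn_itv (divr_ge0 (mulr_ge0 (ler0n R 2) C0) (ltW e0)).
Qed.

End RealFunctions.

(** * Uniform estimates on the unit interval *)

Section SmoothFunctions.
Local Open Scope classical_set_scope.
Local Open Scope ring_scope.
Variable R : realType.
Implicit Types (f g : R -> R) (s t : R).

Lemma smooth_is_derive f t : smooth f -> is_derive t 1 f (derive1 f t).
Proof. by move=> /(_ 0 t) ft; rewrite derive1E; exact: derivableP. Qed.

Lemma smooth_derive1 f : smooth f -> smooth (derive1 f).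
Proof. by move=> fs k t; have := fs k.+1 t; rewrite derive1Sn. Qed.

Lemma smooth_derivable1 f t : smooth f -> derivable (derive1 f) t 1.
Proof. by move=> /(_ 1%N t). Qed.

Lemma bounded_unit f : (forall t, 0 <= t <= 1 -> derivable f t 1) ->
  exists2 L, 0 <= L & forall t, 0 <= t <= 1 -> `|f t| <= L.
Proof.
move=> fd; have fc : {within `[0, 1], continuous f}.
  by apply: derivable_within_continuous => t; rewrite in_itv/=; exact: fd.
have [a _ fa] := EVT_max ler01 fc; have [b _ fb] := EVT_min ler01 fc.
exists (`|f a| + `|f b|); first by rewrite addr_ge0.
move=> t t01; have := fa t; have := fb t; rewrite in_itv/= t01.
move=> /(_ isT) bt /(_ isT) ta; rewrite ler_norml; apply/andP; split.
  have := ler_norm (- f b); have := normr_ge0 (f a); rewrite normrN; lra.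
have := ler_norm (f a); have := normr_ge0 (f b); lra.
Qed.

Lemma mvt_unit f (f' : R -> R) s t : (forall x : R, is_derive x 1 f (f' x)) ->
  0 <= s <= 1 -> 0 <= t <= 1 -> exists c,
  [/\ 0 <= c <= 1, `|c - t| <= `|s - t| & f s - f t = f' c * (s - t)].
Proof.
move=> fd s01 t01; have cont a b : {within `[a, b], continuous f}.
  by apply: derivable_within_continuous => x _; apply: ex_derive.
have [st|ts] := leP s t.
  have [c] := MVT_segment st (fun x _ => fd x) (cont s t).
  rewrite in_itv/= => ct E; exists c; split; first by lra.
    by rewrite !ler0_norm ?subr_le0//; lra.
  by rewrite -opprB E; ring.
have [c] := MVT_segment (ltW ts) (fun x _ => fd x) (cont t s).
rewrite in_itv/= => ct E; exists c; split=> //; first by lra.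
by rewrite !ger0_norm ?subr_ge0//; lra.
Qed.

(** The quadratic estimate needs no Taylor formula: the mean value theorem gives [f' c] with [c] at
    least as close to [t] as [s] is, and [f'] is Lipschitz. *)
Lemma smooth_estimates f : smooth f -> exists2 L, 0 <= L &
  forall s t, 0 <= s <= 1 -> 0 <= t <= 1 ->
  [/\ `|f s - f t| <= L * `|s - t|, `|derive1 f s - derive1 f t| <= L * `|s - t| &
    `|f s - f t - (s - t) * derive1 f t| <= L * (s - t) ^+ 2].
Proof.
move=> fs; have fs1 := smooth_derive1 fs; have fs2 := smooth_derive1 fs1.
have [L1 L10 H1] := bounded_unit (fun t _ => fs1 0 t).
have [L2 L20 H2] := bounded_unit (fun t _ => fs2 0 t).
have lip g K : 0 <= K -> smooth g -> (forall t, 0 <= t <= 1 -> `|derive1 g t| <= K) ->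
    forall s t, 0 <= s <= 1 -> 0 <= t <= 1 -> `|g s - g t| <= K * `|s - t|.
  move=> K0 gs gK s t s01 t01.
  have [c [c01 _ ->]] := mvt_unit (fun x => smooth_is_derive x gs) s01 t01.
  by rewrite normrM ler_wpM2r// gK.
exists (L1 + L2); first by rewrite addr_ge0.
move=> s t s01 t01; split.
- apply: le_trans (lip _ _ L10 fs H1 _ _ s01 t01) _.
  by rewrite ler_wpM2r// lerDl.
- apply: le_trans (lip _ _ L20 fs1 H2 _ _ s01 t01) _.
  by rewrite ler_wpM2r// lerDr.
have [c [c01 ct ->]] := mvt_unit (fun x => smooth_is_derive x fs) s01 t01.
rewrite [_ * (s - t)]mulrC -mulrBr normrM -real_normK ?num_real// expr2 mulrCA.
rewrite ler_wpM2l//; apply: le_trans (lip _ _ L20 fs1 H2 _ _ c01 t01) _.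
by apply: ler_pM; rewrite ?lerDr.
Qed.

(** The relation holds only on [0,1], so at the end points just one-sided increments are available.
    With [a = 1] and [a = -1] this shows that the velocity of a Hermitian curve is Hermitian up to
    the end points, although the extension beyond them is arbitrary. *)
Lemma smooth_derive1_scale (a : R) f g : smooth f -> smooth g ->
  (forall t, 0 <= t <= 1 -> f t = a * g t) ->
  forall t, 0 <= t <= 1 -> derive1 f t = a * derive1 g t.
Proof.
move=> fs gs fg t t01; apply/eqP; rewrite -subr_eq0 -normr_le0 leNgt.
apply/negP; set D := derive1 f t - _ => D0.
have [L L0 fL] := smooth_estimates fs; have [K K0 gK] := smooth_estimates gs.
pose Q := L + `|a| * K + 1.
have Q0 : 0 < Q by rewrite ltr_wpDl// addr_ge0// mulr_ge0.
have near_t s : 0 <= s <= 1 -> s != t -> `|D| <= Q * `|s - t|.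
  move=> s01 st; have [_ _ fT] := fL _ _ s01 t01; have [_ _ gT] := gK _ _ s01 t01.
  have st0 : 0 < `|s - t| by rewrite normr_gt0 subr_eq0.
  rewrite -(ler_pM2l st0) -normrM mulrCA -expr2 real_normK ?num_real//.
  have -> : (s - t) * D = a * (g s - g t - (s - t) * derive1 g t) -
      (f s - f t - (s - t) * derive1 f t) by rewrite !fg// /D; ring.
  apply: le_trans (ler_normB _ _) _; rewrite normrM.
  have : `|a| * `|g s - g t - (s - t) * derive1 g t| <= `|a| * (K * (s - t) ^+ 2).
    by rewrite ler_wpM2l.
  have := sqr_ge0 (s - t); rewrite /Q; lra.
(* At most 1/2, so that [t + d] or [t - d] stays in [0,1], and so small that [Q * d < |D|]
   contradicts [near_t]. *)
pose d := Num.min (2^-1) (`|D| / (2 * Q)).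
have d0 : 0 < d by rewrite lt_min invr_gt0 ltr0n/= divr_gt0// mulr_gt0.
have d2 : d <= 2^-1 by rewrite ge_min lexx.
have dQ : Q * d < `|D|.
  apply: (@le_lt_trans _ _ (Q * (`|D| / (2 * Q)))).
    by rewrite ler_wpM2l ?(ltW Q0)// ge_min lexx orbT.
  have -> : Q * (`|D| / (2 * Q)) = `|D| / 2 by field; rewrite lt0r_neq0.
  by rewrite ltr_pdivrMr// ltr_pMr// ltr1n.
have [t2|t2] := leP t 2^-1.
  have := near_t (t + d); rewrite addrAC subrr add0r (gtr0_norm d0) => H.
  have : `|D| <= Q * d.
    by apply: H; [lra|rewrite -subr_eq0 addrAC subrr add0r lt0r_neq0].
  lra.
have := near_t (t - d); rewrite addrAC subrr add0r normrN (gtr0_norm d0) => H.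
have : `|D| <= Q * d.
  by apply: H; [lra|rewrite -subr_eq0 addrAC subrr add0r oppr_eq0 lt0r_neq0].
lra.
Qed.

End SmoothFunctions.

(** * Complex-valued functions of a real variable *)

Section ComplexDerivability.
Local Open Scope complex_scope.
Variable R : realType.

Lemma derivable_add (f g : R -> R) (t : R) : derivable f t 1 -> derivable g t 1 ->
  derivable (fun s => f s + g s) t 1.
Proof. exact: (@derivableD R R R f g t 1). Qed.

Lemma derivable_opp (f : R -> R) (t : R) : derivable f t 1 ->
  derivable (fun s => - f s) t 1.
Proof. exact: (@derivableN R R R f t 1). Qed.

Lemma derivable_mul (f g : R -> R) (t : R) : derivable f t 1 -> derivable g t 1 ->
  derivable (fun s => f s * g s) t 1.
Proof. exact: (@derivableM R R f g t 1). Qed.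

Local Notation C := R[i].
Implicit Types (f g : R -> C) (t : R).

Definition cderivable f t :=
  derivable (fun s => complex.Re (f s)) t 1 /\
  derivable (fun s => complex.Im (f s)) t 1.

Lemma eq_cderivable f g t : f =1 g -> cderivable f t -> cderivable g t.
Proof. by move=> /funext ->. Qed.

Lemma cderivable_cst (z : C) t : cderivable (fun=> z) t.
Proof. by split; exact: derivable_cst. Qed.

Lemma cderivableD f g t : cderivable f t -> cderivable g t ->
  cderivable (fun s => f s + g s) t.
Proof.
move=> [fr fi] [gr gi]; split.
  under eq_fun do rewrite ReD; exact: derivable_add.
by under eq_fun do rewrite ImD; exact: derivable_add.
Qed.

Lemma ReM (x y : C) : complex.Re (x * y) =
  complex.Re x * complex.Re y - complex.Im x * complex.Im y.
Proof. by case: x y => [a b] [c d]. Qed.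

Lemma ImM (x y : C) : complex.Im (x * y) =
  complex.Re x * complex.Im y + complex.Im x * complex.Re y.
Proof. by case: x y => [a b] [c d]. Qed.

Lemma cderivableM f g t : cderivable f t -> cderivable g t ->
  cderivable (fun s => f s * g s) t.
Proof.
move=> [fr fi] [gr gi]; split.
  under eq_fun do rewrite ReM.
  exact: (derivable_add (derivable_mul fr gr) (derivable_opp (derivable_mul fi gi))).
under eq_fun do rewrite ImM.
exact: (derivable_add (derivable_mul fr gi) (derivable_mul fi gr)).
Qed.

Lemma cderivable_sum (I : Type) (r : seq I) (P : pred I) (F : I -> R -> C) t :
  (forall i, cderivable (F i) t) ->
  cderivable (fun s => \sum_(i <- r | P i) F i s) t.
Proof.
move=> Fd; elim: r => [|i r IH].
  by apply: eq_cderivable (cderivable_cst 0 t) => s; rewrite big_nil.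
have [Pi|Pi] := boolP (P i).
  by apply: eq_cderivable (cderivableD (Fd i) IH) => s; rewrite big_cons Pi.
by apply: eq_cderivable IH => s; rewrite big_cons (negPf Pi).
Qed.

Lemma cderivable_prod (I : Type) (r : seq I) (P : pred I) (F : I -> R -> C) t :
  (forall i, cderivable (F i) t) ->
  cderivable (fun s => \prod_(i <- r | P i) F i s) t.
Proof.
move=> Fd; elim: r => [|i r IH].
  by apply: eq_cderivable (cderivable_cst 1 t) => s; rewrite big_nil.
have [Pi|Pi] := boolP (P i).
  by apply: eq_cderivable (cderivableM (Fd i) IH) => s; rewrite big_cons Pi.
by apply: eq_cderivable IH => s; rewrite big_cons (negPf Pi).
Qed.

Lemma cderivableV f t : f t != 0 -> cderivable f t ->
  cderivable (fun s => (f s)^-1) t.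
Proof.
move=> ft0 [fr fi].
have n0 : complex.Re (f t) * complex.Re (f t) + complex.Im (f t) * complex.Im (f t) != 0.
  apply: contra ft0; rewrite -!expr2 paddr_eq0 ?sqr_ge0// !sqrf_eq0 => /andP[a b].
  by rewrite eq_complex/= a b.
have nd : derivable (fun s => (complex.Re (f s) * complex.Re (f s) +
    complex.Im (f s) * complex.Im (f s))^-1) t 1.
  apply: derivableV; first exact: n0.
  exact: (derivable_add (derivable_mul fr fr) (derivable_mul fi fi)).
have VE z : z^-1 = complex.Re z *
     (complex.Re z * complex.Re z + complex.Im z * complex.Im z)^-1 +i*
   (- (complex.Im z *
     (complex.Re z * complex.Re z + complex.Im z * complex.Im z)^-1)) :> C.
  by case: z => a b; rewrite -!expr2.
split; under eq_fun do rewrite VE.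
  exact: (derivable_mul fr nd).
exact: (derivable_opp (derivable_mul fi nd)).
Qed.

Lemma cderivable_det n (u : R -> 'M[C]_n) t :
  (forall i j, cderivable (fun s => u s i j) t) ->
  cderivable (fun s => \det (u s)) t.
Proof.
move=> ud; apply: cderivable_sum => sigma; apply: cderivableM.
  exact: cderivable_cst.
by apply: cderivable_prod.
Qed.

Lemma cderivable_mulmx m n p (u : R -> 'M[C]_(m, n)) (v : R -> 'M[C]_(n, p)) t :
  (forall i j, cderivable (fun s => u s i j) t) ->
  (forall i j, cderivable (fun s => v s i j) t) ->
  forall i j, cderivable (fun s => (u s *m v s) i j) t.
Proof.
move=> ud vd i j; have H k := cderivableM (ud i k) (vd k j).
by apply: eq_cderivable (cderivable_sum _ _ H) => s; rewrite mxE.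
Qed.

(* invmx is the identity on singular matrices, hence the explicit formula. *)
Lemma cderivable_inv n (u : R -> 'M[C]_n) t : u t \in unitmx ->
  (forall i j, cderivable (fun s => u s i j) t) ->
  forall i j, cderivable (fun s => ((\det (u s))^-1 *: \adj (u s)) i j) t.
Proof.
move=> ut ud i j.
have dV : cderivable (fun s => (\det (u s))^-1) t.
  by apply: cderivableV; [move: ut; rewrite unitmxE unitfE|exact: cderivable_det].
have dA : cderivable (fun s => cofactor (u s) j i) t.
  apply: cderivableM; first exact: cderivable_cst.
  apply: cderivable_det => k l.
  by apply: eq_cderivable (ud (lift j k) (lift i l)) => s; rewrite !mxE.
by apply: eq_cderivable (cderivableM dV dA) => s; rewrite !mxE.
Qed.

End ComplexDerivability.

(** * Lengths of curves *)

Section QformBounds.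
Local Open Scope sesquilinear_scope.
Local Open Scope complex_scope.
Variables (R : realType) (n : nat).
Local Notation M := 'M[R[i]]_n.
Implicit Types (x A : M).

Lemma qform1_ge0 (w : 'cV[R[i]]_n) : 0 <= qform 1%:M w.
Proof. by rewrite qform1 sumr_ge0// => i _; exact: norm2_ge0. Qed.

Lemma qform_bound A w : `|qform A w| <=
  (\sum_i \sum_j (`|complex.Re (A i j)| + `|complex.Im (A i j)|)) * qform 1%:M w.
Proof.
have -> : qform A w =
    \sum_j \sum_i complex.Re ((w i 0)^*%R * A i j * w j 0).
  rewrite /qform mxE (big_morph _ (@ReD R) (erefl : complex.Re 0 = 0)).
  apply: eq_bigr => j _; rewrite mxE mulr_suml.
  rewrite (big_morph _ (@ReD R) (erefl : complex.Re 0 = 0)).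
  by apply: eq_bigr => i _; rewrite !mxE.
rewrite exchange_big/=; apply: le_trans (ler_norm_sum _ _ _) _.
rewrite mulr_suml; apply: ler_sum => i _.
apply: le_trans (ler_norm_sum _ _ _) _.
rewrite mulr_suml; apply: ler_sum => j _.
have w_le k : norm2 (w k 0) <= qform 1%:M w.
  rewrite qform1 (bigD1 k)//= lerDl sumr_ge0// => l _; exact: norm2_ge0.
have := w_le i; have := w_le j; rewrite /norm2.
case: (A i j) (w i 0) (w j 0) => a b [c d] [e f] /=; set q := qform _ _ => ef cd.
have -> : (c * a - - d * b) * e - (c * b + - d * a) * f =
  a * (c * e + d * f) + b * (d * e - c * f) by ring.
apply: le_trans (ler_normD _ _) _; rewrite !normrM mulrDl.
(* Both [|c e + d f|] and [|d e - c f|] are at most [(c^2 + d^2 + e^2 + f^2) / 2 <= q]. *)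
by apply: lerD; rewrite ler_wpM2l// ler_norml; apply/andP; split;
  have := sqr_ge0 (c + e); have := sqr_ge0 (d + f); have := sqr_ge0 (c - e);
  have := sqr_ge0 (d - f); have := sqr_ge0 (d + e); have := sqr_ge0 (c + f);
  have := sqr_ge0 (d - e); have := sqr_ge0 (c - f); lra.
Qed.

Lemma posdefmx_unit x : posdefmx x -> x \in unitmx.
Proof. by move=> px; have [V [mu /sdiag_inv[]]] := sdiag_exists px (adjmx1 R n). Qed.

(** The trace of the inverse dominates its largest eigenvalue. Unlike that eigenvalue, it is visibly
    differentiable along a curve. *)
Lemma posdefmx_lower x w : posdefmx x ->
  qform 1%:M w <= complex.Re (\tr (invmx x)) * qform x w.
Proof.
move=> px; have [V [mu S]] := sdiag_exists px (adjmx1 R n).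
have [_ ->] := sdiag_inv S; have [Vu Vx V1] := S.
rewrite mxtrace_mulC -[V^t*]mulmx1 V1 mxtrace_diag.
have -> : complex.Re (\sum_i (map_mx (real_complex R) mu) 0 i) = \sum_i mu 0 i.
  rewrite (big_morph _ (@ReD R) (erefl : complex.Re 0 = 0)).
  by apply: eq_bigr => i _; rewrite mxE.
have mu0 i : 0 <= mu 0 i by have [_ <-] := sdiag_coef i S; exact: qform1_ge0.
have -> : w = V *m (invmx V *m w) by rewrite mulKVmx.
move: (invmx V *m w) => v; rewrite -!qform_congruence V1 Vx qform_rdiag qform1.
rewrite mulr_sumr; apply: ler_sum => i _; rewrite mulrC ler_wpM2r ?norm2_ge0//.
by rewrite (bigD1 i)//= lerDl sumr_ge0.
Qed.

End QformBounds.

(** * Speed and distance along a smooth curve *)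

Section Curves.
Local Open Scope sesquilinear_scope.
Local Open Scope complex_scope.
Variables (R : realType) (n : nat).
Local Notation M := 'M[R[i]]_n.
Implicit Types (x : M) (h : R -> M) (s t : R).

Lemma smooth_curve_posdef h t : smooth_curve h -> 0 <= t <= 1 -> posdefmx (h t).
Proof. by case=> _; exact. Qed.

Lemma smooth_curve_estimates h : smooth_curve h -> exists2 L, 0 <= L &
  forall s t w, 0 <= s <= 1 -> 0 <= t <= 1 ->
  [/\ `|qform (h s - h t) w| <= L * `|s - t| * qform 1%:M w,
      `|qform (mxdot h s - mxdot h t) w| <= L * `|s - t| * qform 1%:M w &
      `|qform (h s - h t - (s - t)%:C *: mxdot h t) w|
        <= L * (s - t) ^+ 2 * qform 1%:M w].
Proof.
move=> [hs _].
pose P (i j : 'I_n) (K : R) := 0 <= K /\ forall s t, 0 <= s <= 1 -> 0 <= t <= 1 ->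
  [/\ `|complex.Re (h s i j - h t i j)| + `|complex.Im (h s i j - h t i j)|
        <= K * `|s - t|,
      `|complex.Re (mxdot h s i j - mxdot h t i j)|
        + `|complex.Im (mxdot h s i j - mxdot h t i j)| <= K * `|s - t| &
      `|complex.Re (h s i j - h t i j - (s - t)%:C * mxdot h t i j)|
        + `|complex.Im (h s i j - h t i j - (s - t)%:C * mxdot h t i j)|
        <= K * (s - t) ^+ 2].
have ex ij : exists K : R, P ij.1 ij.2 K.
  case: ij => i j /=.
  have [/smooth_estimates[L L0 HL] /smooth_estimates[K K0 HK]] := hs i j.
  exists (L + K); split=> [|s t s01 t01]; first by rewrite addr_ge0.
  have [L1 L2 L3] := HL _ _ s01 t01; have [K1 K2 K3] := HK _ _ s01 t01.
  by rewrite !mxE !(ReD, ImD, ReN, ImN, ReZ, ImZ)/=; split;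
    rewrite [leRHS]mulrDl; apply: lerD.
have [L HL] := choice ex.
exists (\sum_i \sum_j L (i, j)).
  by rewrite sumr_ge0// => i _; rewrite sumr_ge0// => j _; case: (HL (i, j)).
move=> s t w s01 t01.
by split; apply: le_trans (qform_bound _ _) _;
  apply: ler_wpM2r; rewrite ?qform1_ge0// mulr_suml; apply: ler_sum => i _;
  rewrite mulr_suml; apply: ler_sum => j _; have [_ /(_ _ _ s01 t01)[]] := HL (i, j);
  rewrite !mxE.
Qed.

Lemma mxdot_herm h t : smooth_curve h -> 0 <= t <= 1 ->
  (mxdot h t)^t* = mxdot h t.
Proof.
move=> hs t01; apply/matrixP => i j; rewrite !mxE.
have [sm _] := hs; have [rij iij] := sm i j; have [rji iji] := sm j i.
have hE s : 0 <= s <= 1 -> h s i j = (h s j i)^*%R.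
  by move=> /(smooth_curve_posdef hs)/posdefmx_adj/matrixP/(_ i j); rewrite !mxE.
have -> : derive1 (fun s => complex.Re (h s i j)) t =
    1 * derive1 (fun s => complex.Re (h s j i)) t.
  apply: smooth_derive1_scale => // s /hE ->; rewrite mul1r.
  by case: (h s j i).
have -> : derive1 (fun s => complex.Im (h s i j)) t =
    (-1) * derive1 (fun s => complex.Im (h s j i)) t.
  apply: smooth_derive1_scale => // s /hE ->; rewrite mulN1r.
  by case: (h s j i).
by rewrite mul1r mulN1r.
Qed.

Lemma smooth_cderivable h t i j : smooth_curve h -> cderivable (fun s => h s i j) t.
Proof. by case=> /(_ i j)[hr hi] _; split; [exact: (hr 0)|exact: (hi 0)]. Qed.

Lemma invmxE (A : M) : A \in unitmx -> invmx A = (\det A)^-1 *: \adj A.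
Proof. by rewrite /invmx => ->. Qed.

Lemma smooth_curve_lower h : smooth_curve h -> exists2 c, 0 < c &
  forall t w, 0 <= t <= 1 -> c * qform 1%:M w <= qform (h t) w.
Proof.
move=> hs.
have [B B0 HB] : exists2 B, 0 <= B & forall t, 0 <= t <= 1 ->
    `|complex.Re (\tr ((\det (h t))^-1 *: \adj (h t)))| <= B.
  apply: bounded_unit => t t01.
  have hu := posdefmx_unit (smooth_curve_posdef hs t01).
  have H i := cderivable_inv hu (fun i j => smooth_cderivable t i j hs) i i.
  by have [] := cderivable_sum (index_enum 'I_n) xpredT H.
exists (B + 1)^-1; first by rewrite invr_gt0 ltr_wpDl.
move=> t w t01; have pt := smooth_curve_posdef hs t01.
rewrite ler_pdivrMl ?ltr_wpDl//; apply: le_trans (posdefmx_lower w pt) _.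
rewrite ler_wpM2r ?posdefmx_qform_ge0// invmxE ?posdefmx_unit//.
by rewrite (le_trans (ler_norm _))// (le_trans (HB t t01))// lerDl.
Qed.

Section Speed.
Variables (p : R) (chi : R -> R).
Hypotheses (hn : (0 < n)%N) (hchi : Wplus p chi).
Local Notation speed h t := (orlicz_norm chi (h t) (mxdot h t)).

Lemma herm_sub (A B : M) : A^t* = A -> B^t* = B -> (A - B)^t* = A - B.
Proof. by move=> HA HB; rewrite adjmxB HA HB. Qed.

(** Moving the base point multiplies the norm by at most [1 + B * |s - t|], and changing the
    velocity adds at most [B * |s - t|]. As the first error is multiplicative, the speed must also
    be bounded: [K] bounds it by comparison with time 0. *)
Lemma speed_lipschitz h : smooth_curve h -> exists C, forall s t,
  0 <= s <= 1 -> 0 <= t <= 1 -> `|speed h s - speed h t| <= C * `|s - t|.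
Proof.
move=> hs; have [L L0 HL] := smooth_curve_estimates hs.
have [c c0 Hc] := smooth_curve_lower hs.
have ht t : 0 <= t <= 1 -> posdefmx (h t) := smooth_curve_posdef hs.
have dh t : 0 <= t <= 1 -> (mxdot h t)^t* = mxdot h t := mxdot_herm hs.
pose B := L / c; have B0 : 0 <= B by rewrite divr_ge0// ltW.
have LB t w a : 0 <= t <= 1 -> 0 <= a ->
    L * a * qform 1%:M w <= B * a * qform (h t) w.
  move=> t01 a0; have -> : L * a * qform 1%:M w = B * a * (c * qform 1%:M w).
    by rewrite /B; field; rewrite lt0r_neq0.
  by apply: ler_wpM2l; [rewrite mulr_ge0|exact: Hc].
have step s t : 0 <= s <= 1 -> 0 <= t <= 1 ->
    speed h t <= (1 + B * `|s - t|) * speed h s + B * `|s - t|.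
  move=> s01 t01; have d0 : 0 <= B * `|s - t| by rewrite mulr_ge0.
  have -> : speed h t =
      orlicz_norm chi (h t) (mxdot h s + (mxdot h t - mxdot h s)).
    by rewrite addrC subrK.
  apply: le_trans (orlicz_normD hn hchi (ht _ t01) (dh _ s01) _) _.
    by apply: herm_sub; apply: dh.
  apply: lerD.
    apply: (orlicz_norm_le_base hn hchi (ht _ s01) (ht _ t01) (dh _ s01)).
      by rewrite ltr_wpDr.
    move=> w; rewrite mulrDl mul1r.
    have -> : h s = h t + (h s - h t) by rewrite addrC subrK.
    rewrite qformD lerD2l; apply: le_trans (ler_norm _) _.
    by have [+ _ _] := HL _ _ w s01 t01; move=> /le_trans; apply; exact: LB.
  apply: (orlicz_norm_le hn hchi (ht _ t01)) => //.
    by apply: herm_sub; apply: dh.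
  move=> w; have [_ + _] := HL _ _ w t01 s01; rewrite distrC => /le_trans; apply.
  exact: LB.
pose K := (1 + B) * speed h 0 + B.
have z01 : 0 <= (0 : R) <= 1 by rewrite lexx ler01.
have s0 t : 0 <= speed h t by exact: orlicz_norm_ge0.
have bnd t : 0 <= t <= 1 -> speed h t <= K.
  move=> t01; apply: le_trans (step _ _ z01 t01) _; rewrite sub0r normrN /K.
  have : B * `|t| <= B by rewrite ler_piMr// ger0_norm; lra.
  move=> Bt; apply: lerD => //; rewrite ler_wpM2r ?s0//; lra.
exists (B * (K + 1)) => s t s01 t01.
have one a b : 0 <= a <= 1 -> 0 <= b <= 1 ->
    speed h a - speed h b <= B * (K + 1) * `|b - a|.
  move=> a01 b01; have := step _ _ b01 a01.
  have : B * `|b - a| * speed h b <= B * `|b - a| * K.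
    by apply: ler_wpM2l; [rewrite mulr_ge0|exact: bnd].
  rewrite (mulrAC B (K + 1)); move: (speed h a) (speed h b) (B * `|b - a|) K {bnd s0 step}.
  by move=> u v d k; lra.
rewrite ler_norml; apply/andP; split.
  by rewrite lerNl opprB one.
by rewrite distrC one.
Qed.

Lemma log_dist_increment x h : posdefmx x -> smooth_curve h ->
  exists C, forall s t, 0 <= s <= 1 -> 0 <= t <= 1 ->
  log_dist chi x (h t) - log_dist chi x (h s)
    <= `|t - s| * speed h t + C * (t - s) ^+ 2.
Proof.
move=> px hs; have [L L0 HL] := smooth_curve_estimates hs.
have [c c0 Hc] := smooth_curve_lower hs.
have ht t : 0 <= t <= 1 -> posdefmx (h t) := smooth_curve_posdef hs.
have dh t : 0 <= t <= 1 -> (mxdot h t)^t* = mxdot h t := mxdot_herm hs.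
(* The estimates along [h] are relative to the standard form, while [log_dist_step] wants them
   relative to [x]; [X] and [Y] convert between the two. *)
pose X := 1 + \sum_i \sum_j (`|complex.Re (x i j)| + `|complex.Im (x i j)|).
have X0 : 0 < X.
  rewrite ltr_pwDl//; apply: sumr_ge0 => i _; apply: sumr_ge0 => j _.
  exact: addr_ge0.
have xX w : qform x w <= X * qform 1%:M w.
  apply: le_trans (ler_norm _) _; apply: le_trans (qform_bound _ _) _.
  by rewrite ler_wpM2r ?qform1_ge0// lerDr.
pose Y := 1 + `|complex.Re (\tr (invmx x))|.
have Y0 : 0 < Y by rewrite ltr_pwDl.
have xY w : qform 1%:M w <= Y * qform x w.
  apply: le_trans (posdefmx_lower w px) _.
  rewrite ler_wpM2r ?posdefmx_qform_ge0//; apply: le_trans (ler_norm _) _.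
  by rewrite lerDr.
have cX0 : 0 < c / X by rewrite divr_gt0.
have hx t w : 0 <= t <= 1 -> c / X * qform x w <= qform (h t) w.
  move=> t01; apply: le_trans (Hc t w t01); rewrite -mulrA ler_wpM2l ?(ltW c0)//.
  by rewrite ler_pdivrMl.
exists (L / c + (L * Y / (c / X)) ^+ 2) => s t s01 t01.
have k0 : 0 <= L * Y * `|s - t| by rewrite !mulr_ge0// ltW.
have := log_dist_step hn hchi px (ht _ t01) (ht _ s01) cX0
  (fun w => hx t w t01) (fun w => hx s w s01) k0.
have Hst w : `|qform (h s - h t) w| <= L * Y * `|s - t| * qform x w.
  have [+ _ _] := HL _ _ w s01 t01; move=> /le_trans; apply.
  by rewrite -!mulrA ler_wpM2l// mulrCA ler_wpM2l.
move=> /(_ Hst).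
(* The chord is [s - t] times the velocity at [t], up to a second-order rest. *)
have : orlicz_norm chi (h t) (h s - h t) <=
    `|t - s| * speed h t + L / c * (t - s) ^+ 2.
  have Hd : ((s - t)%:C *: mxdot h t)^t* = (s - t)%:C *: mxdot h t.
    by rewrite adjmxZ dh.
  have -> : h s - h t = (s - t)%:C *: mxdot h t +
      (h s - h t - (s - t)%:C *: mxdot h t) by rewrite [RHS]addrC subrK.
  have Hr : (h s - h t - (s - t)%:C *: mxdot h t)^t* =
      h s - h t - (s - t)%:C *: mxdot h t.
    by apply: herm_sub => //; apply: herm_sub; apply: posdefmx_adj; apply: ht.
  apply: le_trans (orlicz_normD hn hchi (ht _ t01) Hd Hr) _; apply: lerD.
    rewrite (orlicz_normZ hn hchi (s - t) (ht _ t01) (dh _ t01)) distrC.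
    exact: lexx.
  apply: (orlicz_norm_le hn hchi (ht _ t01) Hr).
    by rewrite mulr_ge0 ?sqr_ge0// divr_ge0// ltW.
  move=> w; have [_ _ +] := HL _ _ w s01 t01; move=> /le_trans; apply.
  have -> : L * (s - t) ^+ 2 * qform 1%:M w =
      L / c * (t - s) ^+ 2 * (c * qform 1%:M w).
    by field; rewrite lt0r_neq0.
  apply: ler_wpM2l; last exact: Hc.
  by rewrite mulr_ge0 ?sqr_ge0// divr_ge0// ltW.
have -> : (L * Y * `|s - t| / (c / X)) ^+ 2 = (L * Y / (c / X)) ^+ 2 * (t - s) ^+ 2.
  by rewrite mulrAC exprMn distrC real_normK ?num_real.
rewrite mulrDl; move: (log_dist _ _ _) (log_dist _ _ _) (orlicz_norm _ _ (_ - _)).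
move: (L / c * _) (_ ^+ 2 * _) (`|t - s| * _) => a b d u v w; lra.
Qed.

Lemma log_dist_le_length x h : posdefmx x -> smooth_curve h ->
  ((log_dist chi x (h 1) - log_dist chi x (h 0))%:E <= curve_length chi h)%E.
Proof.
move=> px hs; have [C HC] := speed_lipschitz hs.
have [K HK] := log_dist_increment px hs.
have H s t : 0 <= s <= 1 -> 0 <= t <= 1 -> `|speed h s - speed h t|
    <= (`|C| + `|K|) * `|s - t|.
  move=> s01 t01; apply: le_trans (HC _ _ s01 t01) _.
  by rewrite ler_wpM2r// (le_trans (ler_norm _))// lerDl.
apply: (@increment_le_integral R (`|C| + `|K|) (fun t => speed h t)
  (fun t => log_dist chi x (h t))) => //.
- by move=> t _; exact: orlicz_norm_ge0.
- move=> s t s01 t01; apply: le_trans (HK _ _ s01 t01) _.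
  rewrite lerD2l ler_wpM2r ?sqr_ge0//.
  by rewrite (le_trans (ler_norm _))// lerDr.
Qed.

End Speed.

End Curves.

(** * Geodesics *)

Section OrdinaryDifferentialEquations.
Local Open Scope classical_set_scope.
Local Open Scope ring_scope.
Variable R : realType.
Implicit Types (f : R -> R) (t : R).

Lemma derive0_const f : (forall t, 0 <= t <= 1 -> derivable f t 1) ->
  (forall t, 0 < t < 1 -> derive1 f t = 0) ->
  forall t, 0 <= t <= 1 -> f t = f 0.
Proof.
move=> fd f0 t /andP[t0 t1].
have cont : {within `[0, t], continuous f}.
  apply: derivable_within_continuous => x; rewrite in_itv/= => x0t.
  by apply: fd; lra.
have df (x : R) : x \in `]0, t[ -> is_derive x 1 f (cst 0 x).
  rewrite in_itv/= => x0t; have x01 : 0 <= x <= 1 by lra.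
  have := derivableP (fd x x01); rewrite -derive1E f0//; lra.
have [c _] := MVT_segment t0 df cont.
by rewrite mul0r => /eqP; rewrite subr_eq0 => /eqP.
Qed.

(** The integrating factor [expR (- a * t)] turns [f] into a constant. *)
Lemma ode_exp (a : R) f (f' : R -> R) : (forall t : R, is_derive t 1 f (f' t)) ->
  (forall t, 0 <= t <= 1 -> f' t = a * f t) ->
  forall t, 0 <= t <= 1 -> f t = expR (t * a) * f 0.
Proof.
move=> fd fa; pose g := (fun s => expR (- a * s)) * f.
have ed (t : R) : is_derive t 1 (fun s => expR (- a * s)) (- a * expR (- a * t)).
  rewrite mulrC; apply: (@is_derive1_comp R expR (fun s => - a * s) t).
  by have := is_deriveZ (- a) (is_derive_id t (1 : R)); rewrite /GRing.scale/= mulr1.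
have gd (t : R) : is_derive t 1 g
    (expR (- a * t) *: f' t + f t *: (- a * expR (- a * t))).
  exact: (is_deriveM (ed t) (fd t)).
have gc t : 0 <= t <= 1 -> g t = g 0.
  apply: derive0_const => [s _|s s01].
    by case: (gd s).
  have [_ dE] := gd s; rewrite derive1E dE fa; last lra.
  by rewrite /GRing.scale/=; ring.
move=> t t01; have := gc t t01; rewrite /g !fctE mulr0 expR0 mul1r => <-.
by rewrite mulrA -expRD mulNr mulrC [t * a]mulrC subrr expR0 mulr1.
Qed.

Lemma smooth_expsum n (c a : 'I_n -> R) :
  smooth (fun t => \sum_k c k * expR (t * a k)) /\
  derive1 (fun t => \sum_k c k * expR (t * a k)) =
    fun t => \sum_k (c k * a k) * expR (t * a k).
Proof.
have D (c' : 'I_n -> R) (t : R) : is_derive t 1 (fun t => \sum_k c' k * expR (t * a k))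
    (\sum_k (c' k * a k) * expR (t * a k)).
  have -> : (fun t => \sum_k c' k * expR (t * a k)) =
      \sum_(k < n) (fun t => c' k * expR (t * a k)).
    by apply/funext => s; rewrite fct_sumE.
  apply: is_derive_sum => k.
  have ed : is_derive t 1 (fun s => expR (s * a k)) (expR (t * a k) * a k).
    apply: (@is_derive1_comp R expR (fun s => s * a k) t).
    have := is_deriveZ (a k) (is_derive_id t (1 : R)).
    rewrite /GRing.scale/= mulr1; congr is_derive.
    by apply/funext => s; rewrite /= mulrC.
  have := is_deriveZ (c' k) ed; rewrite /GRing.scale/=.
  by rewrite mulrAC mulrA.
have DE (c' : 'I_n -> R) : derive1 (fun t => \sum_k c' k * expR (t * a k)) =
    fun t => \sum_k (c' k * a k) * expR (t * a k).
  by apply/funext => t; have [_ H] := D c' t; rewrite derive1E H.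
split=> // k; elim: k c {DE} (DE) => [|k IH] c DE t.
  by have [] := D c t.
by rewrite derive1Sn DE; exact: IH.
Qed.

End OrdinaryDifferentialEquations.

(** * Solving the geodesic equation *)

Section MatrixCurves.
Local Open Scope sesquilinear_scope.
Local Open Scope complex_scope.
Variables (R : realType) (n : nat).
Local Notation C := R[i].
Local Notation M := 'M[C]_n.
Implicit Types (u g : R -> M) (s t : R).

Definition cis_derive (f : R -> C) (t : R) (d : C) :=
  is_derive t 1 (fun s => complex.Re (f s)) (complex.Re d) /\
  is_derive t 1 (fun s => complex.Im (f s)) (complex.Im d).

Lemma cis_deriveD (f g : R -> C) (t : R) a b : cis_derive f t a -> cis_derive g t b ->
  cis_derive (fun s => f s + g s) t (a + b).
Proof.
move=> [fr fi] [gr gi]; split.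
  rewrite ReD (_ : (fun _ => _) =
    (fun s => complex.Re (f s)) + (fun s => complex.Re (g s))).
    exact: is_deriveD.
  by apply/funext => s; rewrite ReD.
rewrite ImD (_ : (fun _ => _) =
    (fun s => complex.Im (f s)) + (fun s => complex.Im (g s))).
  exact: is_deriveD.
by apply/funext => s; rewrite ImD.
Qed.

Lemma cis_deriveZ (f : R -> C) (t : R) z a : cis_derive f t a ->
  cis_derive (fun s => z * f s) t (z * a).
Proof.
move=> [fr fi]; split.
  rewrite ReM (_ : (fun _ => _) = complex.Re z \*: (fun s => complex.Re (f s)) -
     complex.Im z \*: (fun s => complex.Im (f s))).
    exact: (is_deriveB (is_deriveZ _ fr) (is_deriveZ _ fi)).
  by apply/funext => s; rewrite ReM.
rewrite ImM (_ : (fun _ => _) = complex.Re z \*: (fun s => complex.Im (f s)) +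
   complex.Im z \*: (fun s => complex.Re (f s))).
  exact: (is_deriveD (is_deriveZ _ fi) (is_deriveZ _ fr)).
by apply/funext => s; rewrite ImM.
Qed.

Lemma cis_derive_sum (I : Type) (r : seq I) (F : I -> R -> C) (t : R) (D : I -> C) :
  (forall i, cis_derive (F i) t (D i)) ->
  cis_derive (fun s => \sum_(i <- r) F i s) t (\sum_(i <- r) D i).
Proof.
move=> Fd; elim: r => [|i r IH].
  rewrite big_nil (_ : (fun _ => _) = fun=> 0); last first.
    by apply/funext => s; rewrite big_nil.
  by split; exact: is_derive_cst.
rewrite big_cons (_ : (fun _ => _) = fun s => F i s + \sum_(j <- r) F j s).
  exact: cis_deriveD.
by apply/funext => s; rewrite big_cons.
Qed.

Definition mx_is_derive u (t : R) (D : M) :=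
  forall i j, cis_derive (fun s => u s i j) t (D i j).

Lemma mx_is_deriveM (A B : M) u t D : mx_is_derive u t D ->
  mx_is_derive (fun s => A *m u s *m B) t (A *m D *m B).
Proof.
move=> uD i j; pose F k l s := A i l * B k j * u s l k.
have -> : (fun s => (A *m u s *m B) i j) = fun s => \sum_k \sum_l F k l s.
  apply/funext => s; rewrite mxE; apply: eq_bigr => k _; rewrite mxE mulr_suml.
  by apply: eq_bigr => l _; rewrite /F mulrAC.
have -> : (A *m D *m B) i j = \sum_k \sum_l A i l * B k j * D l k.
  rewrite mxE; apply: eq_bigr => k _; rewrite mxE mulr_suml.
  by apply: eq_bigr => l _; rewrite mulrAC.
apply: cis_derive_sum => k; apply: cis_derive_sum => l.
by apply: cis_deriveZ; exact: uD.
Qed.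

Lemma smooth_mx_is_derive u t : smooth_curve u -> mx_is_derive u t (mxdot u t).
Proof.
case=> us _ i j; have [ur ui] := us i j.
by rewrite /cis_derive mxE /=; split; exact: smooth_is_derive.
Qed.

Lemma geodesic_velocity u t : smooth_curve u -> geodesic_equation u ->
  0 <= t <= 1 -> mxdot u t = u t *m (invmx (u 0) *m mxdot u 0).
Proof.
move=> us ug t01.
have uu s : 0 <= s <= 1 -> u s \in unitmx.
  by move=> /(smooth_curve_posdef us)/posdefmx_unit.
(* This agrees with [invmx (u s)] on [0,1] and is differentiable there, end points included.
   Agreement in a neighbourhood is shown only at interior points, which suffices for constancy. *)
pose v s := (\det (u s))^-1 *: \adj (u s).
pose A s := v s *m mxdot u s.
have AE s : 0 <= s <= 1 -> invmx (u s) *m mxdot u s = A s.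
  by move=> s01; rewrite invmxE ?uu.
have Ad s i j : 0 <= s <= 1 -> cderivable (fun r => A r i j) s.
  move=> s01; apply: cderivable_mulmx => k l.
    apply: cderivable_inv; first exact: uu.
    by move=> a b; exact: smooth_cderivable.
  have [/(_ k l)[ur ui] _] := us.
  have E : (fun r => mxdot u r k l) =1 fun r =>
      derive1 (fun x => complex.Re (u x k l)) r +i*
      derive1 (fun x => complex.Im (u x k l)) r by move=> r; rewrite mxE.
  apply: (eq_cderivable (fun r => esym (E r))).
  by split; [exact: smooth_derivable1 ur|exact: smooth_derivable1 ui].
have near_eq s : 0 < s < 1 ->
    \forall r \near s, invmx (u r) *m mxdot u r = A r.
  move=> s01; have : s \in `]0, 1[ by rewrite in_itv.
  move=> /near_in_itvoo; apply: filterS => r; rewrite in_itv/= => r01.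
  apply: AE; lra.
have Adot s i j : 0 < s < 1 ->
    derive1 (fun r => complex.Re (A r i j)) s = 0 /\
    derive1 (fun r => complex.Im (A r i j)) s = 0.
  move=> s01; have s01' : 0 <= s <= 1 by lra.
  have /matrixP/(_ i j) := ug s s01'; rewrite !mxE => -[R0 I0].
  split; [apply: etrans R0|apply: etrans I0]; rewrite !derive1E;
    apply: near_eq_derive; apply: filterS (near_eq s s01) => r ->; reflexivity.
have Ac s : 0 <= s <= 1 -> A s = A 0.
  move=> s01; apply/matrixP => i j; apply/eqP; rewrite eq_complex; apply/andP.
  split; apply/eqP.
    apply: (derive0_const (f := fun r => complex.Re (A r i j))) => // r r01.
      have [dr di] := Ad r i j r01; assumption.
    by case: (Adot r i j r01).
  apply: (derive0_const (f := fun r => complex.Im (A r i j))) => // r r01.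
    have [dr di] := Ad r i j r01; assumption.
  by case: (Adot r i j r01).
rewrite AE ?lexx ?ler01// -(Ac t t01) -AE//.
by rewrite (mulKVmx (uu _ t01)).
Qed.

Definition exp_row (a : 'rV[R]_n) t : 'rV[R]_n := \row_i expR (t * a 0 i).

Lemma exp_row0 a : exp_row a 0 = const_mx 1.
Proof. by apply/rowP => i; rewrite !mxE mul0r expR0. Qed.

Lemma rdiag_expD a s t : rdiag (exp_row a s) *m rdiag (exp_row a t) =
  rdiag (exp_row a (s + t)).
Proof.
rewrite rdiagM; apply: (congr1 (@rdiag R n)).
by apply/rowP => i; rewrite !mxE -expRD mulrDl.
Qed.

(** Diagonalizing the initial point and the initial velocity together decouples the system: entry
    [(i, j)] solves [y' = a_j y]. Off-diagonal entries start at 0 and stay there. *)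
Lemma geodesic_diag u : smooth_curve u -> geodesic_equation u ->
  exists V a, V \in unitmx /\ forall t, 0 <= t <= 1 ->
    V^t* *m u t *m V = rdiag (exp_row a t) /\
    mxdot u t = u t *m (V *m rdiag a *m invmx V).
Proof.
move=> us ug; have z01 : 0 <= (0 : R) <= 1 by rewrite lexx ler01.
have p0 := smooth_curve_posdef us z01.
have [V [a S]] := sdiag_exists p0 (mxdot_herm us z01).
have [Vu V0 V1] := S; exists V, a; split => // t t01.
have dE s : 0 <= s <= 1 -> mxdot u s = u s *m (V *m rdiag a *m invmx V).
  by move=> s01; rewrite (geodesic_velocity us ug s01) (sdiag_mulE S).
split; last exact: dE.
have yD (s : R) := mx_is_deriveM (V^t*) V (smooth_mx_is_derive s us).
have yE s i j : 0 <= s <= 1 -> (V^t* *m mxdot u s *m V) i j =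
    (a 0 j)%:C * (V^t* *m u s *m V) i j.
  move=> s01; rewrite (dE _ s01) -!mulmxA (mulVmx Vu) mulmx1 !mulmxA.
  by rewrite mulmx_rdiagE mulrC.
apply/matrixP => i j; apply/eqP; rewrite eq_complex.
have /matrixP/(_ i j) := V0; rewrite [RHS]mxE => y0.
have -> : rdiag (exp_row a t) i j = (expR (t * a 0 j))%:C * (V^t* *m u 0 *m V) i j.
  rewrite y0 rdiagE mxE; case: eqP => [->|_]; first by rewrite !mulr1n mulr1.
  by rewrite !mulr0n mulr0.
rewrite ReZ ImZ; apply/andP; split; apply/eqP.
  apply: (ode_exp (f := fun s => complex.Re ((V^t* *m u s *m V) i j))
    (f' := fun s => complex.Re ((V^t* *m mxdot u s *m V) i j))) => // s.
    by have [] := yD s i j.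
  by move=> s01; rewrite yE// ReZ.
apply: (ode_exp (f := fun s => complex.Im ((V^t* *m u s *m V) i j))
  (f' := fun s => complex.Im ((V^t* *m mxdot u s *m V) i j))) => // s.
  by have [] := yD s i j.
by move=> s01; rewrite yE// ImZ.
Qed.

(** Rescaling by [exp (- s a / 2)] makes the basis orthonormal at time [s]. With [D] the velocity
    and [b = a] this gives constant speed; with [D = u t] and [b = exp ((t - s) a)] it gives
    distances along the geodesic. *)
Lemma geodesic_sdiag u (V D : M) (a b : 'rV[R]_n) s : V \in unitmx ->
  V^t* *m u s *m V = rdiag (exp_row a s) ->
  V^t* *m D *m V = rdiag (exp_row a s) *m rdiag b ->
  sdiag (u s) D (V *m rdiag (exp_row a (- s / 2))) b.
Proof.
move=> Vu us HD; have E : rdiag (exp_row a (- s / 2)) *m (rdiag (exp_row a s) *m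
    rdiag (exp_row a (- s / 2))) = 1%:M.
  rewrite !rdiag_expD -rdiag1 -(exp_row0 a).
  by apply: (congr1 (fun x => rdiag (exp_row a x))); field.
have com (e c : 'rV[R]_n) : rdiag e *m rdiag c = rdiag c *m rdiag e.
  rewrite !rdiagM; apply: (congr1 (@rdiag R n)).
  by apply/rowP => i; rewrite !mxE mulrC.
have Eu : rdiag (exp_row a (- s / 2)) \in @unitmx C n by case/mulmx1_unit: E.
split.
- by rewrite unitmx_mul Vu Eu.
- rewrite adjmxM rdiag_adj -!mulmxA (mulmxA (u s)) (mulmxA (V^t*)).
  by rewrite (mulmxA (V^t*)) us E.
- rewrite adjmxM rdiag_adj -!mulmxA (mulmxA D) (mulmxA (V^t*)).
  rewrite (mulmxA (V^t*)) HD -[RHS]mul1mx -E -!mulmxA; congr (_ *m (_ *m _)).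
  exact: com.
Qed.

End MatrixCurves.

Section Geodesics.
Local Open Scope sesquilinear_scope.
Local Open Scope complex_scope.
Variables (R : realType) (n : nat) (p : R) (chi : R -> R).
Hypotheses (hn : (0 < n)%N) (hchi : Wplus p chi).
Local Notation M := 'M[R[i]]_n.
Implicit Types (u g : R -> M) (x y z v : M) (s t : R).

Let z01 : 0 <= (0 : R) <= 1. Proof. by rewrite lexx ler01. Qed.
Let o01 : 0 <= (1 : R) <= 1. Proof. by rewrite lexx ler01. Qed.

Lemma geodesic_metrics u : smooth_curve u -> geodesic_equation u ->
  exists V a, [/\ V \in unitmx,
    forall t, 0 <= t <= 1 -> V^t* *m u t *m V = rdiag (exp_row a t),
    forall s t, 0 <= s <= 1 -> 0 <= t <= 1 ->
      log_dist chi (u s) (u t) = `|s - t| * gauge chi a &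
    curve_length chi u = (gauge chi a)%:E].
Proof.
move=> us ug; have [V [a [Vu H]]] := geodesic_diag us ug.
exists V, a; split => //.
- by move=> t /H[].
- move=> s t /H[Hs _] /H[Ht _].
  have := @geodesic_sdiag _ _ u V (u t) a (exp_row a (t - s)) s Vu Hs.
  rewrite rdiag_expD addrC subrK => /(_ Ht) S.
  rewrite (log_distE chi hn S) distrC -(gaugeZ hchi); congr gauge.
  by apply/rowP => i; rewrite !mxE expRK.
- rewrite /curve_length.
  transitivity (\int[lebesgue_measure]_(t in `[0%R, 1%R]) cst (gauge chi a)%:E t)%E.
    apply: eq_integral => t; rewrite inE/= in_itv/= => /H[Ht dE].
    have HD : V^t* *m mxdot u t *m V = rdiag (exp_row a t) *m rdiag a.
      rewrite dE -Ht -!mulmxA (mulVmx Vu) mulmx1; reflexivity.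
    by rewrite (orlicz_norm_gauge chi hn (geodesic_sdiag Vu Ht HD)).
  rewrite integral_cst//= [X in (_ * X)%E](@lebesgue_measure_itv R `[0, 1]).
  by rewrite /= lte_fin ltr01 oppr0 adde0 mule1.
Qed.

Lemma posdefmx_rdiag (W : M) (d : 'rV[R]_n) : W \in unitmx ->
  (forall i, 0 < d 0 i) -> posdefmx (W^t* *m rdiag d *m W).
Proof.
move=> Wu d0; apply: posdefmxP; first exact/herm_congruence/rdiag_adj.
move=> w w0; rewrite qform_congruence qform_rdiag.
have : W *m w != 0.
  by apply: contra w0 => /eqP E; rewrite -(mulKmx Wu w) E mulmx0.
move: (W *m w) => {w w0} w w0.
have [i wi] : exists i, w i 0 != 0.
  apply/existsP; apply: contraNT w0; rewrite negb_exists => /forallP w0.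
  by apply/eqP/colP => i; rewrite mxE; apply/eqP; rewrite -[_ == _]negbK w0.
rewrite (bigD1 i)//= ltr_pwDl//; last first.
  by apply: sumr_ge0 => j _; rewrite mulr_ge0 ?norm2_ge0// ltW.
rewrite mulr_gt0// lt_def norm2_ge0 andbT; apply: contra wi.
rewrite /norm2 paddr_eq0 ?sqr_ge0// !sqrf_eq0 => /andP[re0 im0].
by rewrite eq_complex/= re0 im0.
Qed.

Lemma candidate_geodesic_exists v0 v1 : posdefmx v0 -> posdefmx v1 ->
  exists g, candidate_geodesic v0 v1 g.
Proof.
move=> p0 p1; have [V [mu S]] := sdiag_exists p0 (posdefmx_adj p1).
have [Vu _ _] := S; pose W := invmx V.
have Wu : W \in unitmx by rewrite unitmx_inv.
have mu0 i : 0 < mu 0 i.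
  have [V0 <-] := sdiag_coef i S; apply: posdefmx_qform_gt0 p1 _.
  apply/eqP => E; move: V0; rewrite E /qform mulmx0 mxE /= => /eqP.
  by rewrite eq_sym oner_eq0.
pose a := map_mx (@ln R) mu.
pose g t := W^t* *m rdiag (exp_row a t) *m W.
(* Coefficients that write the entries of [g] as sums of exponentials, which are smooth on the whole
   line. *)
pose c i j k := (W^t*) i k * W k j.
have gE t i j : g t i j = \sum_k (expR (t * a 0 k))%:C * c i j k.
  rewrite mxE; apply: eq_bigr => k _.
  by rewrite mulmx_rdiagE /c [exp_row _ _ _ _]mxE mulrAC mulrC.
have gRe i j : (fun t => complex.Re (g t i j)) =
    fun t => \sum_k complex.Re (c i j k) * expR (t * a 0 k).
  apply/funext => t; rewrite gE (big_morph _ (@ReD R) (erefl : complex.Re 0 = 0)).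
  by apply: eq_bigr => k _; rewrite ReZ mulrC.
have gIm i j : (fun t => complex.Im (g t i j)) =
    fun t => \sum_k complex.Im (c i j k) * expR (t * a 0 k).
  apply/funext => t; rewrite gE (big_morph _ (@ImD R) (erefl : complex.Im 0 = 0)).
  by apply: eq_bigr => k _; rewrite ImZ mulrC.
have gdot t : mxdot g t = g t *m (V *m rdiag a *m W).
  have -> : g t *m (V *m rdiag a *m W) =
      W^t* *m rdiag (\row_k (expR (t * a 0 k) * a 0 k)) *m W.
    rewrite /g -!mulmxA (mulmxA W) (mulVmx Vu) mul1mx (mulmxA (rdiag _)) rdiagM.
    congr (_ *m (rdiag _ *m _)); by apply/rowP => k; rewrite !mxE.
  apply/matrixP => i j; rewrite [LHS]mxE gRe gIm.
  have [_ ->] := smooth_expsum (fun k => complex.Re (c i j k)) (fun k => a 0 k).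
  have [_ ->] := smooth_expsum (fun k => complex.Im (c i j k)) (fun k => a 0 k).
  have -> : (W^t* *m rdiag (\row_k (expR (t * a 0 k) * a 0 k)) *m W) i j =
      \sum_k (a 0 k * expR (t * a 0 k))%:C * c i j k.
    rewrite mxE; apply: eq_bigr => k _; rewrite mulmx_rdiagE /c [(\row_ _ _) _ _]mxE.
    by rewrite mulrAC mulrC [a 0 k * _]mulrC.
  apply/eqP; rewrite eq_complex /= (big_morph _ (@ReD R) (erefl : complex.Re 0 = 0)).
  rewrite (big_morph _ (@ImD R) (erefl : complex.Im 0 = 0)).
  apply/andP; split; apply/eqP; apply: eq_bigr => k _.
    by rewrite ReZ -mulrA mulrC.
  by rewrite ImZ -mulrA mulrC.
have gp t : posdefmx (g t).
  by apply: posdefmx_rdiag Wu _ => i; rewrite mxE expR_gt0.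
exists g; split.
- split=> [i j|t _]; last exact: gp.
  rewrite gRe gIm; split.
    exact: (smooth_expsum (fun k => complex.Re (c i j k)) (fun k => a 0 k)).1.
  exact: (smooth_expsum (fun k => complex.Im (c i j k)) (fun k => a 0 k)).1.
- move=> t _.
  have -> : (fun s => invmx (g s) *m mxdot g s) = fun=> V *m rdiag a *m W.
    by apply/funext => s; rewrite gdot (mulKmx (posdefmx_unit (gp s))).
  by apply/matrixP => i j; rewrite !mxE !derive1_cst.
- by rewrite /g exp_row0 rdiag1 mulmx1 -(sdiag_xE S).
- have E : exp_row a 1 = mu.
    by apply/rowP => i; rewrite !mxE mul1r lnK// posrE.
  by rewrite /g E -(sdiag_phiE S).
Qed.

Lemma candidate_geodesic_unique v0 v1 g g' : candidate_geodesic v0 v1 g ->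
  candidate_geodesic v0 v1 g' -> forall t, 0 <= t <= 1 -> g' t = g t.
Proof.
have form u : candidate_geodesic v0 v1 u -> exists V a, [/\ V \in unitmx,
    invmx v0 *m v1 = V *m rdiag (exp_row a 1) *m invmx V &
    forall t, 0 <= t <= 1 -> u t = v0 *m (V *m rdiag (exp_row a t) *m invmx V)].
  move=> [us ug u0 u1]; have [V [a [Vu H _ _]]] := geodesic_metrics us ug.
  have S t (t01 : 0 <= t <= 1) : sdiag v0 (u t) V (exp_row a t).
    by split=> //; [rewrite -u0 H// exp_row0 rdiag1|exact: H].
  exists V, a; split => // [|t t01]; first by rewrite -u1; exact: sdiag_mulE (S 1 o01).
  have [v0u _] := sdiag_inv (S t t01).
  by rewrite -(sdiag_mulE (S t t01)) (mulKVmx v0u).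
move=> /form[V [a [Vu E H]]] /form[V' [a' [Vu' E' H']]] t t01.
rewrite (H t t01) (H' t t01); apply: (congr1 (mulmx v0)).
(* Every solution is [v0] times the power [t] of [invmx v0 *m v1], and a power is a function of the
   matrix alone, not of its diagonalization. *)
have pow (b : 'rV[R]_n) : exp_row b t = map_mx (fun r => expR (t * ln r)) (exp_row b 1).
  by apply/rowP => i; rewrite !mxE expRK mul1r.
by rewrite !pow; apply: rdiag_similar_map; rewrite -?E' -?E.
Qed.

Lemma log_dist_refl x : posdefmx x -> log_dist chi x x = 0.
Proof.
move=> px; have [V [mu S]] := sdiag_exists px (posdefmx_adj px).
rewrite (log_distE chi hn S) -(gauge0 n hchi); congr gauge.
by apply/rowP => i; have [x1 mE] := sdiag_coef i S; rewrite !mxE -mE x1 ln1.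
Qed.

Lemma candidate_geodesic_length v0 v1 g : candidate_geodesic v0 v1 g ->
  curve_length chi g = (log_dist chi v0 v1)%:E.
Proof.
move=> [us ug <- <-]; have [V [a [_ _ D ->]]] := geodesic_metrics us ug.
by rewrite D// sub0r normrN1 mul1r.
Qed.

(** Asymmetric by definition, the distance along a geodesic is [|s - t|] times a constant, which is
    symmetric in [s] and [t]. *)
Lemma log_dist_sym x y : posdefmx x -> posdefmx y ->
  log_dist chi x y = log_dist chi y x.
Proof.
move=> px py; have [g [us ug <- <-]] := candidate_geodesic_exists px py.
have [V [a [_ _ D _]]] := geodesic_metrics us ug.
by rewrite !D// distrC.
Qed.

Lemma log_dist_eq0 x y : posdefmx x -> posdefmx y ->
  log_dist chi x y = 0 -> x = y.
Proof.
move=> px py; have [g [us ug <- <-]] := candidate_geodesic_exists px py.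
have [V [a [Vu H D _]]] := geodesic_metrics us ug.
rewrite D// sub0r normrN1 mul1r => /(gauge_eq0 hchi) a0.
have Vu' : V^t* \in unitmx by rewrite adjmx_unit.
apply: (can_inj (mulKmx Vu')); apply: (can_inj (mulmxK Vu)) => /=.
rewrite !H//; congr (rdiag _); apply/rowP => i.
by rewrite !mxE a0 mxE !mulr0.
Qed.

Lemma log_dist_triangle x y z : posdefmx x -> posdefmx y -> posdefmx z ->
  log_dist chi x z <= log_dist chi x y + log_dist chi y z.
Proof.
move=> px py pz; have [g cg] := candidate_geodesic_exists py pz.
have := candidate_geodesic_length cg; have [us ug g0 g1] := cg.
have := log_dist_le_length hn hchi px us; rewrite g0 g1 => + E.
by rewrite E lee_fin lerBlDl.
Qed.

Lemma log_dist_le_curve_length u : smooth_curve u ->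
  ((log_dist chi (u 0) (u 1))%:E <= curve_length chi u)%E.
Proof.
move=> us; have p0 := smooth_curve_posdef us z01.
have := log_dist_le_length hn hchi p0 us.
by rewrite log_dist_refl// subr0.
Qed.

Lemma orlicz_distE v0 v1 : posdefmx v0 -> posdefmx v1 ->
  orlicz_dist chi v0 v1 = (log_dist chi v0 v1)%:E.
Proof.
move=> p0 p1; have [g cg] := candidate_geodesic_exists p0 p1.
apply/eqP; rewrite eq_le; apply/andP; split.
  rewrite -(candidate_geodesic_length cg); apply: ereal_inf_lbound.
  by have [us _ g0 g1] := cg; exists g.
apply: le_ereal_inf_tmp => _ [u [us u0 u1] <-].
by rewrite -u0 -u1; exact: log_dist_le_curve_length.
Qed.

Lemma geodesic_metric_geodesic g : smooth_curve g -> geodesic_equation g ->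
  metric_geodesic (@posdefmx R n) (orlicz_dist chi) g.
Proof.
move=> us ug; have pg t : 0 <= t <= 1 -> posdefmx (g t) := smooth_curve_posdef us.
have [V [a [_ _ D _]]] := geodesic_metrics us ug.
split=> [//|s t s01 t01].
rewrite (orlicz_distE (pg s s01) (pg t t01)) (orlicz_distE (pg 0 z01) (pg 1 o01)).
by rewrite (D s t s01 t01) (D 0 1 z01 o01) sub0r normrN1 mul1r EFinM.
Qed.

Lemma orlicz_dist_geodesic_space :
  is_geodesic_metric_space (@posdefmx R n) (orlicz_dist chi).
Proof.
split; last first.
  move=> x y px py; have [g [us ug g0 g1]] := candidate_geodesic_exists px py.
  by exists g; split; [exact: geodesic_metric_geodesic|exact: g0|exact: g1].
split=> [x y px py|x y px py|x y px py|x y z px py pz].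
- by rewrite (orlicz_distE px py) lee_fin orlicz_norm_ge0.
- rewrite (orlicz_distE px py); split=> [[]|->]; first exact: log_dist_eq0.
  by rewrite (log_dist_refl py).
- by rewrite (orlicz_distE px py) (orlicz_distE py px) (log_dist_sym px py).
- rewrite (orlicz_distE px py) (orlicz_distE py pz) (orlicz_distE px pz).
  by rewrite -EFinD lee_fin log_dist_triangle.
Qed.

End Geodesics.

Theorem theorem3p5 (R : realType) (n : nat) (hn : (0 < n)%N)
    (p : R) (hp : 1 <= p) (chi : R -> R) (hchi : Wplus p chi) :
  (forall v0 v1 : 'M[R[i]]_n, posdefmx v0 -> posdefmx v1 ->
     exists g : R -> 'M[R[i]]_n, candidate_geodesic v0 v1 g /\
       forall g' : R -> 'M[R[i]]_n, candidate_geodesic v0 v1 g' ->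
         forall t : R, 0 <= t <= 1 -> g' t = g t) /\
  (forall h g : R -> 'M[R[i]]_n,
     smooth_curve h -> h 0 <> h 1 -> candidate_geodesic (h 0) (h 1) g ->
     [/\ (curve_length chi g <= curve_length chi h)%E,
         orlicz_dist chi (h 0) (h 1) = curve_length chi g
       & (0 < curve_length chi g)%E]) /\
  is_geodesic_metric_space (@posdefmx R n) (orlicz_dist chi) /\
  (forall g : R -> 'M[R[i]]_n, smooth_curve g -> geodesic_equation g ->
     metric_geodesic (@posdefmx R n) (orlicz_dist chi) g).
Proof.
split.
  move=> v0 v1 p0 p1; have [g cg] := candidate_geodesic_exists p0 p1.
  exists g; split=> // g' cg'; exact: (candidate_geodesic_unique hn hchi cg cg').
split; last first.
  split; first exact: orlicz_dist_geodesic_space hn hchi.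
  exact: geodesic_metric_geodesic hn hchi.
move=> h g hs h01 cg.
have p0 : posdefmx (h 0) by apply: smooth_curve_posdef hs _; rewrite lexx ler01.
have p1 : posdefmx (h 1) by apply: smooth_curve_posdef hs _; rewrite lexx ler01.
rewrite (candidate_geodesic_length hn hchi cg); split.
- exact: (log_dist_le_curve_length hn hchi hs).
- exact: (orlicz_distE hn hchi p0 p1).
- rewrite lte_fin lt_def orlicz_norm_ge0 andbT; apply/eqP.
  by move=> /(log_dist_eq0 hn hchi p0 p1).
Qed.
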